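(* Let $R$ be a finite ring and $K$ a field. The following are equivalent: (1) the unitary Cayley graph $\Gamma(R)$ is Cohen–Macaulay over $K$; (2) $\Gamma(R)$ is well-covered and shellable; (3) either $R$ is a field or $R\cong \mathbb{Z}_2^k$ for some positive integer $k$.
   Context: All rings are finite, associative, with a nonzero identity. The unitary Cayley graph $\Gamma(R)$ has vertex set $R$, with distinct $x,y$ adjacent iff $x-y$ is a unit of $R$. A graph is well-covered if all its maximal independent sets have the same size. For a graph $G$ on vertex set $[N]$, its edge ideal is $I(G)=\langle x_ix_j : \{i,j\}\in E(G)\rangle\subseteq S=K[x_1,\dots,x_N]$, and $G$ is Cohen–Macaulay over $K$ if $S/I(G)$ is a Cohen–Macaulay ring. The independence complex $\mathrm{Ind}(G)$ is the simplicial complex of independent sets of $G$. A simplicial complex is shellable if its facets can be ordered $F_1,\dots,F_t$ so that for each $i>1$ the complex $\langle F_1,\dots,F_{i-1}\rangle\cap\langle F_i\rangle$ (where $\langle\cdot\rangle$ denotes the complex generated by the listed facets) is pure of dimension $\dim F_i-1$; a graph is shellable if its independence complex is. *)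

(* Defs.v *)
From HB Require Import structures.
From mathcomp Require Import all_boot all_order all_algebra.
From mathcomp Require Import boolp.
From mathcomp.multinomials Require Import mpoly.

Set Implicit Arguments.
Unset Strict Implicit.
Unset Printing Implicit Defensive.

Import GRing.Theory.
Local Open Scope ring_scope.

(* Graphs are symmetric irreflexive relations, simplicial complexes are given by
   their sets of faces. *)
Section Graphs.
Variable V : finType.
Implicit Types (e : rel V) (A B : {set V}).

Definition independent e A : bool :=
  [forall x in A, forall y in A, ~~ e x y].

Definition well_covered e : Prop :=
  forall A B, maxset (independent e) A -> maxset (independent e) B ->
    #|A| = #|B|.

End Graphs.

Section Complexes.
Variable V : finType.
Implicit Types (D : {set {set V}}) (F : {set V}) (s : seq {set V}).

Definition facets D : {set {set V}} := [set F | maxset (fun A : {set V} => A \in D) F].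

(* The empty face has dimension -1. *)
Definition face_dim F : int := #|F|%:Z - 1.

Definition complex_of s : {set {set V}} :=
  [set A : {set V} | has (fun F : {set V} => A \subset F) s].

Definition pure_of_dim D (d : int) : Prop :=
  forall F, F \in facets D -> face_dim F = d.

(* Non-pure shellability: the facets need not all have the same dimension.
   Indices start at 0, so [take i s] lists the facets preceding the i-th. *)
Definition shellable_complex D : Prop :=
  exists s : seq {set V},
    [/\ uniq s, s =i facets D &
        forall i, (0 < i < size s)%N ->
          pure_of_dim
            (complex_of (take i s) :&: complex_of [:: nth set0 s i])
            (face_dim (nth set0 s i) - 1)].

Definition independence_complex (e : rel V) : {set {set V}} :=
  [set A | independent e A].

Definition shellable (e : rel V) : Prop :=
  shellable_complex (independence_complex e).

End Complexes.

(* Ideals are boolean predicates, as in [ring_quotient]; classically nothing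
   is lost, since every predicate is of this form (see [asbool]).  Recall that
   [idealr_closed] describes the proper ideals. *)
Section CohenMacaulay.
Variable A : comNzRingType.
Implicit Types (I J P : {pred A}) (xs : seq A).

Definition ideal_span xs : {pred A} :=
  fun a => `[< exists c : nat -> A, a = \sum_(i < size xs) c i * xs`_i >].

Definition prime_ideal P : Prop := idealr_closed P /\ prime_idealr_closed P.

Definition maximal_ideal P : Prop :=
  idealr_closed P /\
  forall J, idealr_closed J -> {subset P <= J} -> {subset J <= P}.

(* The unit ideal is generated by 1, so only proper ideals matter. *)
Definition noetherian : Prop :=
  forall J, idealr_closed J -> exists xs, J =i ideal_span xs.

(* Q 0 < Q 1 < ... < Q n = P *)
Definition prime_chain_to P (n : nat) (Q : nat -> {pred A}) : Prop :=
  [/\ forall i, (i <= n)%N -> prime_ideal (Q i),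
      forall i, (i < n)%N ->
        {subset Q i <= Q i.+1} /\ ~ {subset Q i.+1 <= Q i} &
      Q n =i P].

Definition codim_is P (d : nat) : Prop :=
  (exists Q, prime_chain_to P d Q) /\
  (forall n Q, prime_chain_to P n Q -> (n <= d)%N).

(* The i-th element is a nonzerodivisor modulo the previous ones, and the
   quotient by the whole sequence is nonzero. *)
Definition regular_sequence xs : Prop :=
  (forall i, (i < size xs)%N -> forall a : A,
     xs`_i * a \in ideal_span (take i xs) -> a \in ideal_span (take i xs)) /\
  1 \notin ideal_span xs.

Definition depth_is P (d : nat) : Prop :=
  (exists xs, [/\ regular_sequence xs, {subset xs <= P} & size xs = d]) /\
  (forall xs, regular_sequence xs -> {subset xs <= P} -> (size xs <= d)%N).

(* Eisenbud, Commutative Algebra, 18.2: a Noetherian ring is Cohen-Macaulay if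
   depth(P, A) = codim P for every maximal ideal P. *)
Definition cohen_macaulay_ring : Prop :=
  noetherian /\
  forall P, maximal_ideal P -> exists d, codim_is P d /\ depth_is P d.

End CohenMacaulay.

Lemma ideal_span_closed (A : comNzRingType) (xs : seq A) :
  1 \notin ideal_span xs -> idealr_closed (ideal_span xs).
Proof.
move=> n1; split=> //.
  apply/asboolP; exists (fun=> 0).
  by rewrite big1 // => i _; rewrite mul0r.
move=> a u v /asboolP[c ->] /asboolP[d ->]; apply/asboolP.
exists (fun i => a * c i + d i); rewrite mulr_sumr -big_split /=.
by apply: eq_bigr => i _; rewrite mulrDl mulrA.
Qed.

(* The vertex v corresponds to the variable of index [enum_rank v]. *)
Section EdgeIdeal.
Variables (K : fieldType) (V : finType) (e : rel V).

Definition edge_monomials : seq {mpoly K[#|V|]} :=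
  [seq 'X_(enum_rank p.1) * 'X_(enum_rank p.2)
     | p : V * V <- enum [pred p : V * V | e p.1 p.2]].

Definition edge_ideal : pred {mpoly K[#|V|]} := ideal_span edge_monomials.

Lemma edge_ideal_proper : 1 \notin edge_ideal.
Proof.
apply/negP => /asboolP[c /(congr1 (mmap idfun (fun=> 0)))].
rewrite rmorph1 rmorph_sum big1 => [/eqP|i _]; first by rewrite oner_eq0.
have /mapP[p _ ->] := mem_nth 0 (ltn_ord i).
by rewrite !rmorphM /= !mmapX !mmap1U !mulr0.
Qed.

HB.instance Definition _ :=
  isIdealr.Build {mpoly K[#|V|]} edge_ideal (ideal_span_closed edge_ideal_proper).

Definition edge_idealr : idealr {mpoly K[#|V|]} := Idealr.clone _ edge_ideal _.

Definition edge_ring : comNzRingType := {ideal_quot edge_idealr}.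

Definition cohen_macaulay_graph : Prop := cohen_macaulay_ring edge_ring.

End EdgeIdeal.

(* Not necessarily commutative.  A [finUnitRingType] is just a finite nonzero
   ring: invertibility is decidable there (see [FinRing.isNzRing]). *)
Definition unitary_cayley (R : finUnitRingType) : rel R :=
  [rel x y : R | (x != y) && (x - y \is a GRing.unit)].

Lemma unitary_cayley_sym (R : finUnitRingType) : ssrbool.symmetric (@unitary_cayley R).
Proof.
by move=> x y; rewrite /unitary_cayley /= [x == y]eq_sym -opprB unitrN.
Qed.

Lemma unitary_cayley_irr (R : finUnitRingType) :
  irreflexive (@unitary_cayley R).
Proof. by move=> x; rewrite /unitary_cayley /= eqxx. Qed.

Definition is_field (R : finUnitRingType) : Prop :=
  (forall x y : R, x * y = y * x) /\
  (forall x : R, x != 0 -> x \is a GRing.unit).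

(* {ffun 'I_k -> 'Z_2} carries the pointwise (product) ring structure. *)
Definition is_Z2_power (R : finUnitRingType) (k : nat) : Prop :=
  exists f : {rmorphism R -> {ffun 'I_k -> 'Z_2}}, bijective f.

(* Main.v *)
(* Both (1) and (2) imply that every maximal independent set F of the graph
   meets another one in codimension one, i.e. that some vertex outside F has
   exactly one neighbour in F.  Shellings give this directly.  For (1) this is
   Hartshorne's connectedness theorem: otherwise the variables outside F and
   their annihilator generate an ideal J of the Stanley-Reisner ring whose
   quotient has dimension at most |F| - 2, so that any |F| - 1 members of a
   regular sequence of length |F| are algebraically dependent modulo J.  The
   resulting elements g = al + be of J, where al is in the ideal of the variables
   and be in the annihilator, are polynomials in the regular sequence, and the
   fraction al / g has one such denominator g avoiding each member of the
   sequence, so it lies in the local ring at the origin; being a nontrivial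
   idempotent, it cannot.

   A maximal left ideal L is a maximal independent set because the units act
   transitively on the nonzero vectors of R / L.  The single neighbour property
   for L then says that the units embed in R / L, so the difference of two
   distinct units is a unit.  Hence R is reduced, and a nontrivial idempotent
   forces 1 to be the only unit; R is a field or a Boolean ring.

   Conversely, in these cases the graph is a disjoint union of cliques, the
   independence complex is shellable by exchanging one vertex at a time, and for
   a maximal ideal P Zariski's lemma gives polynomials p_i in the sums t_i of the
   variables of each clique with p_i(t_i) in P; they form a regular sequence
   whose length is the number of cliques, which bounds the length of all chains
   of primes. *)
Require Import Defs.
From HB Require Import structures.
From mathcomp Require Import all_boot all_order all_algebra.
From mathcomp Require Import finfield zify ring.
From mathcomp Require Import boolp.
From mathcomp.multinomials Require Import mpoly.

Set Implicit Arguments.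
Unset Strict Implicit.
Unset Printing Implicit Defensive.

Import GRing.Theory.
Local Open Scope ring_scope.

(** * Units and maximal left ideals of finite rings *)

Section FiniteRing.
Variable R : finUnitRingType.
Implicit Types (x y u v e : R) (L : {set R}).

Lemma finring_linv_unit x y : x * y = 1 -> (x \is a GRing.unit) && (y \is a GRing.unit).
Proof.
move=> xy1.
have inj_y : injective ( *%R y).
  by move=> r s /(congr1 ( *%R x)); rewrite !mulrA xy1 !mul1r.
have [g _ gK] := injF_bij inj_y.
have yg : y * g 1 = 1 by apply: gK.
have gx : g 1 = x by rewrite -[g 1]mul1r -[X in X * _]xy1 -mulrA yg mulr1.
rewrite gx in yg.
by apply/andP; split; apply/unitrP; [exists y|exists x].
Qed.

Lemma finring_idem_pow x : exists2 m, (0 < m)%N & x ^+ m * x ^+ m = x ^+ m.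
Proof.
have /injectivePn[i [j nij eij]] : ~~ injectiveb (fun i : 'I_(#|R|.+1) => x ^+ i).
  by apply/negP=> /injectiveP /leq_card; rewrite card_ord ltnn.
wlog ltij : i j nij eij / (i < j)%N.
  move=> W; case: (ltngtP i j) => [l|l|/val_inj ev]; first exact: W l.
    by apply: (W j i) => //; rewrite eq_sym.
  by rewrite ev eqxx in nij.
pose p := (j - i)%N.
have p_gt0 : (0 < p)%N by rewrite subn_gt0.
have per n : (i <= n)%N -> x ^+ (n + p) = x ^+ n.
  move=> lin; rewrite -(subnK lin) -addnA exprD /p subnKC 1?ltnW // -eij.
  by rewrite -exprD.
have pert n t : (i <= n)%N -> x ^+ (n + p * t) = x ^+ n.
  move=> lin; elim: t => [|t IH]; first by rewrite muln0 addn0.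
  by rewrite mulnS addnCA addnC per ?IH // (leq_trans lin) ?leq_addr.
exists (p * i.+1)%N; first by rewrite muln_gt0 p_gt0.
by rewrite -exprD pert // (leq_trans (leqnSn i)) // leq_pmull.
Qed.

Definition lideal L : bool :=
  [&& 0 \in L, [forall x in L, forall y in L, x - y \in L] &
      [forall r : R, forall x in L, r * x \in L]] && (1 \notin L).

Section LeftIdeal.
Variable L : {set R}.
Hypothesis LI : lideal L.

Lemma lideal0 : 0 \in L. Proof. by case/andP: LI => /and3P[]. Qed.
Lemma lidealB x y : x \in L -> y \in L -> x - y \in L.
Proof.
by case/andP: LI => /and3P[_ /forall_inP H _] _ /H /forall_inP; apply.
Qed.
Lemma lidealM x y : y \in L -> x * y \in L.
Proof.
by case/andP: LI => /and3P[_ _ /forallP/(_ x)/forall_inP H] _ /H.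
Qed.
Lemma lideal1 : 1 \notin L. Proof. by case/andP: LI. Qed.
Lemma lidealN x : x \in L -> - x \in L.
Proof. by move=> xL; rewrite -sub0r lidealB ?lideal0. Qed.
Lemma lidealD x y : x \in L -> y \in L -> x + y \in L.
Proof. by move=> xL yL; rewrite -[y]opprK lidealB ?lidealN. Qed.

Lemma lideal_nunit x : x \in L -> x \isn't a GRing.unit.
Proof.
by move=> xL; apply: contra lideal1 => ux; rewrite -(mulVr ux) lidealM.
Qed.

End LeftIdeal.

Lemma nunit_maxlideal x : x \isn't a GRing.unit ->
  exists2 L, maxset lideal L & x \in L.
Proof.
move=> nux; pose Lx := [set r * x | r : R].
have : lideal Lx.
  apply/andP; split; first apply/and3P; first split.
  - by apply/imsetP; exists 0; rewrite ?mul0r.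
  - apply/forall_inP=> _ /imsetP[r _ ->]; apply/forall_inP=> _ /imsetP[s _ ->].
    by apply/imsetP; exists (r - s); rewrite ?mulrBl.
  - apply/forallP=> s; apply/forall_inP=> _ /imsetP[r _ ->].
    by apply/imsetP; exists (s * r); rewrite ?mulrA.
  apply: contra nux => /imsetP[r _ /esym/finring_linv_unit].
  by case/andP.
case/maxset_exists=> L ML sub; exists L => //; apply: (subsetP sub).
by apply/imsetP; exists 1; rewrite ?mul1r.
Qed.

Section MaxLeftIdeal.
Variable L : {set R}.
Hypothesis ML : maxset lideal L.

Let LI : lideal L. Proof. by case/maxsetP: ML. Qed.

Lemma maxlideal_gen x y : x \notin L -> exists r, y - r * x \in L.
Proof.
move=> xL; pose L' := [set z | [exists r, z - r * x \in L]].
have sub : L \subset L'.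
  by apply/subsetP=> z zL; rewrite inE; apply/existsP; exists 0; rewrite mul0r subr0.
have xL' : x \in L'.
  by rewrite inE; apply/existsP; exists 1; rewrite mul1r subrr lideal0.
suff /existsP[r rP] : [exists r, 1 - r * x \in L].
  by exists (y * r); rewrite -mulrA -{1}[y]mulr1 -mulrBr lidealM.
apply: contraT => n1; exfalso.
have /setP/(_ x) : L' = L; last by rewrite xL' (negbTE xL).
have [_ max] := maxsetP ML; apply: max => //.
apply/andP; split; first apply/and3P; first split.
- by rewrite (subsetP sub) ?lideal0.
- apply/forall_inP=> z; rewrite inE => /existsP[r rP].
  apply/forall_inP=> t; rewrite inE => /existsP[s sP].
  rewrite inE; apply/existsP; exists (r - s).
  suff -> : z - t - (r - s) * x = (z - r * x) - (t - s * x) by rewrite lidealB.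
  by rewrite mulrBl !opprB addrACA [RHS]addrACA [- t - _]addrC.
- apply/forallP=> s; apply/forall_inP=> z; rewrite inE => /existsP[r rP].
  rewrite inE; apply/existsP; exists (s * r).
  by rewrite -mulrA -mulrBr lidealM.
- by rewrite inE.
Qed.

(* [equivU x y]: the classes of [x] and [y] in the simple module [R / L] lie in
   the same orbit of the group of units. *)
Let equivU x y := exists2 g, g \is a GRing.unit & g * x - y \in L.

Let equivU_sym x y : equivU x y -> equivU y x.
Proof.
case=> g ug gP; exists g^-1; first by rewrite unitrV.
rewrite -[x](mulKr ug) -mulrBr lidealM //.
by rewrite -opprB lidealN.
Qed.

Let equivU_trans x y z : equivU x y -> equivU y z -> equivU x z.
Proof.
move=> [g ug gP] [h uh hP]; exists (h * g); first by rewrite unitrMl.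
have := lidealD LI (lidealM LI h gP) hP.
by rewrite mulrBr mulrA addrA subrK.
Qed.

Lemma idem_compl e : e * e = e -> (1 - e) * (1 - e) = 1 - e.
Proof. by move=> ee; rewrite mulrBl mul1r mulrBr mulr1 ee subrr subr0. Qed.

(* The transvections [1 + e r (1 - e)]. *)
Let transv e y z : e * e = e -> (1 - e) * y \notin L ->
  equivU y (e * z + (1 - e) * y).
Proof.
move=> ee; have [f fE] : exists f, f = 1 - e by exists (1 - e).
rewrite -!fE => fyL.
have fe : f * e = 0 by rewrite fE mulrBl mul1r ee subrr.
have [r rP] := maxlideal_gen (z - y) fyL.
exists (1 + e * r * f).
  have sq : e * r * f * (e * r * f) = 0.
    by rewrite !mulrA -[e * r * f * e]mulrA fe mulr0 !mul0r.
  suff /finring_linv_unit/andP[] : (1 + e * r * f) * (1 - e * r * f) = 1 by [].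
  move: (e * r * f) sq => w sq.
  by rewrite mulrDl mul1r mulrBr mulr1 sq subr0 subrK.
have fy : f * y = y - e * y by rewrite fE mulrBl mul1r.
have -> : (1 + e * r * f) * y - (e * z + f * y) = - (e * (z - y - r * (f * y))).
  rewrite mulrDl mul1r [in LHS]fy !mulrBr !opprB !mulrA.
  move: (e * r * f * y) (e * y) (e * z) => a b c.
  rewrite opprD opprB [y + a]addrC -!addrA; congr (a + _).
  by rewrite addrC -!addrA addNr addr0 addrC.
by rewrite lidealN // lidealM.
Qed.

Lemma maxlideal_transitive x : x \notin L ->
  exists2 u, u \is a GRing.unit & x - u \in L.
Proof.
move=> xL.
suff [g ug gP] : equivU 1 x.
  by exists g => //; rewrite -opprB lidealN // -{1}[g]mulr1.
have n1 := lideal1 LI.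
case: (boolP [exists e, [&& e * e == e, [exists r, e * r \notin L]
               & [exists r, (1 - e) * r \notin L]]]).
  case/existsP=> e /and3P[/eqP ee /existsP[r0 r0L] /existsP[r1 r1L]].
  have ff := idem_compl ee.
  set f := 1 - e in r1L ff *.
  have fe : f * e = 0 by rewrite /f mulrBl mul1r ee subrr.
  have ef : e * f = 0 by rewrite /f mulrBr mulr1 ee subrr.
  have e_f : 1 - f = e by rewrite /f opprB addrCA subrr addr0.
  suff all y : y \notin L -> equivU y (e * r0 + f * r1).
    by apply: equivU_trans (all _ n1) _; apply/equivU_sym/all.
  move=> yL.
  have : (e * y \notin L) || (f * y \notin L).
    rewrite -negb_and; apply: contra yL => /andP[eyL fyL].
    by rewrite -[y]mul1r -(subrK e 1) mulrDl lidealD.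
  have fromf z : f * z \notin L -> equivU z (e * r0 + f * r1).
    move=> fz; apply: (equivU_trans (transv r0 ee fz)); rewrite -/f.
    have h := @transv f (e * r0 + f * z) r1 ff.
    rewrite e_f !mulrDr !mulrA ee ef mul0r addr0 in h.
    by rewrite [e * r0 + f * r1]addrC; apply: h.
  case/orP => [ey|]; last exact: fromf.
  have h := @transv f y r1 ff; rewrite e_f in h.
  apply: (equivU_trans (h ey)); apply: fromf.
  by rewrite mulrDr !mulrA ff fe mul0r addr0.
move=> /existsPn noe.
have idem e : e * e = e -> (forall r, e * r \in L) \/ (forall r, (1 - e) * r \in L).
  move=> ee; have := noe e; rewrite ee eqxx /= negb_and.
  by case/orP=> /existsPn H; [left|right] => r; have := H r; rewrite negbK.
(* Now every element acts on [R / L] either bijectively or nilpotently. *)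
pose nil a := exists2 m, (0 < m)%N & forall r, a ^+ m * r \in L.
have nilP a : nil a \/ exists2 b, (forall r, (1 - b * a) * r \in L) & GRing.comm a b.
  have [m m0 em] := finring_idem_pow a.
  case: (idem _ em) => H; first by left; exists m.
  right; exists (a ^+ m.-1); last exact: commrX.
  by rewrite -exprSr prednK.
have killed_nil a r : r \notin L -> a * r \in L -> nil a.
  move=> rL arL; case: (nilP a) => // -[b bP _]; case/negP: rL.
  by rewrite -[r]mul1r -[1](subrK (b * a)) mulrDl lidealD // -mulrA lidealM.
have nil_nker a : nil a -> exists2 r, r \notin L & a * r \in L.
  case=> m m0 H.
  pose P k := a ^+ k \in L.
  have exP : exists k, P k by exists m; rewrite /P -[a ^+ m]mulr1.
  case: (ex_minnP exP) => k Pk mink.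
  case: k Pk mink => [|k] Pk mink; first by rewrite /P expr0 (negbTE n1) in Pk.
  exists (a ^+ k); last by rewrite -exprS.
  by apply/negP=> /mink; rewrite ltnn.
have nilMl a r : nil a -> nil (r * a).
  move=> /nil_nker[s sL asL]; apply: (killed_nil _ s) => //.
  by rewrite -mulrA lidealM.
have nil_nfix a s : nil a -> s \notin L -> s - a * s \notin L.
  move=> [m m0 H]; apply: contra => sasL.
  suff : s - a ^+ m * s \in L by move/(lidealD LI (H s)); rewrite addrC subrK.
  elim: m {m0 H} => [|m IH]; first by rewrite expr0 mul1r subrr lideal0.
  have := lidealD LI IH (lidealM LI (a ^+ m) sasL).
  by rewrite mulrBr addrA subrK mulrA -exprSr.
have nilN a : nil a -> nil (- a) by rewrite -mulN1r; apply: nilMl.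
have nilD a b : nil a -> nil b -> nil (a + b).
  move=> na nb; case: (nilP (a + b)) => // -[c cP _].
  have /nil_nker[s sL bsL] := nilMl b c nb.
  case/negP: (nil_nfix _ _ (nilMl a c na) sL).
  have := lidealD LI (cP s) bsL.
  by rewrite mulrBl mul1r mulrDr mulrDl opprD addrA subrK.
have xnil : ~ nil x.
  move=> nx; case/negP: xL.
  pose N := [set z | `[< nil z >]].
  have <- : N = L; last by rewrite inE; apply/asboolP.
  have [_ max] := maxsetP ML; apply: max.
    apply/andP; split; first apply/and3P; first split.
    - rewrite inE; apply/asboolP; exists 1%N => // r.
      by rewrite expr1 mul0r lideal0.
    - apply/forall_inP=> z; rewrite inE => /asboolP nz.
      apply/forall_inP=> t; rewrite inE => /asboolP nt.
      by rewrite inE; apply/asboolP/nilD => //; apply: nilN.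
    - apply/forallP=> s; apply/forall_inP=> z; rewrite inE => /asboolP nz.
      by rewrite inE; apply/asboolP/nilMl.
    - rewrite inE; apply/negP=> /asboolP[m m0 /(_ 1)].
      by rewrite expr1n mul1r; apply/negP.
  by apply/subsetP=> z zL; rewrite inE; apply/asboolP/(killed_nil _ 1); rewrite ?mulr1.
have [m m0 em] := finring_idem_pow x.
case: (idem _ em) => H; first by case: xnil; exists m.
set e := x ^+ m in em H.
have xe : GRing.comm x e by apply: commrX.
have fe : (1 - e) * e = 0 by rewrite mulrBl mul1r em subrr.
have ef : e * (1 - e) = 0 by rewrite mulrBr mulr1 em subrr.
have ff := idem_compl em.
exists (x * e + (1 - e)); last first.
  rewrite mulr1 -opprB lidealN // opprD addrA -{1}[x]mulr1 -mulrBr.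
  by rewrite lidealB // -[1 - e]mulr1 // lidealM.
have [f fE] : exists f, f = 1 - e by exists (1 - e).
rewrite -fE in fe ef ff *.
suff /finring_linv_unit/andP[] : (x * e + f) * (x ^+ m.-1 * e + f) = 1 by [].
have pe : x ^+ m.-1 * e = e * x ^+ m.-1 by rewrite /e -!exprD addnC.
have fpe : f * (x ^+ m.-1 * e) = 0 by rewrite pe mulrA fe mul0r.
have epe : x * e * (x ^+ m.-1 * e) = e.
  by rewrite -mulrA pe [e * (e * _)]mulrA em -pe mulrA -exprS prednK.
rewrite mulrDl !mulrDr ff fpe epe -mulrA ef mulr0 addr0 add0r.
by rewrite fE addrC subrK.
Qed.
End MaxLeftIdeal.
End FiniteRing.

(* Some vertex outside [F] has a single neighbour in [F], that is, [F] meets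
   another maximal independent set in codimension one. *)
Definition has_private_nbr (V : finType) (e : rel V) (F : {set V}) : Prop :=
  exists a b, [/\ a \in F, b \notin F, e b a &
                  forall a', a' \in F -> e b a' -> a' = a].

Section Rigidity.
Variable R : finUnitRingType.
Implicit Types (x y u v e : R) (L F : {set R}).
Local Notation G := (@unitary_cayley R).

Lemma maxlideal_maxindep L : maxset (@lideal R) L -> maxset (independent G) L.
Proof.
move=> ML; have [LI _] := maxsetP ML.
apply/maxsetP; split.
  apply/forall_inP=> x xL; apply/forall_inP=> y yL; rewrite negb_and.
  by rewrite (lideal_nunit LI) ?orbT // lidealB.
move=> B IB sLB; apply/eqP; rewrite eqEsubset sLB andbT; apply/subsetP=> x xB.
apply: contraT => xL; have [u uu xuL] := maxlideal_transitive ML xL.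
have /forall_inP/(_ _ xB)/forall_inP/(_ _ (subsetP sLB _ xuL)) := IB.
rewrite /unitary_cayley /= opprB addrCA subrr addr0 uu andbT negbK.
by move=> /eqP xE; rewrite {1}xE xuL in xL.
Qed.

Hypothesis HN : forall F, maxset (independent G) F -> has_private_nbr G F.

Lemma unitB u v : u \is a GRing.unit -> v \is a GRing.unit -> u != v ->
  u - v \is a GRing.unit.
Proof.
move=> uu uv nuv; apply: contraT => /nunit_maxlideal[L ML uvL].
have [LI _] := maxsetP ML.
have [a [b [aL bL /andP[_ uba] uniq]]] := HN (maxlideal_maxindep ML).
have bvL : (b - a) * v^-1 * (u - v) \in L by rewrite lidealM.
have ba : b - a != 0 by apply: contraTneq uba => ->; rewrite unitr0.
set l := (b - a) * v^-1 * (u - v) in bvL.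
have lE : (b - a) + l = (b - a) * v^-1 * u.
  by rewrite /l mulrBr mulrVK // addrC subrK.
have : a - l = a.
  apply: uniq; first exact: lidealB.
  apply/andP; split.
    by apply: contraNneq bL => ->; apply: lidealB.
  by rewrite opprB addrCA addrC lE !unitrMl ?unitrV.
rewrite -[RHS]subr0 => /addrI/oppr_inj l0.
have uw : (b - a) * v^-1 \is a GRing.unit by rewrite unitrMl ?unitrV.
have : u - v = 0 by rewrite -[u - v](mulKr uw) -/l l0 mulr0.
by move/eqP; rewrite subr_eq0 (negbTE nuv).
Qed.

Lemma no_square_zero x : x * x = 0 -> x = 0.
Proof.
move=> xx; apply: contraTeq isT => nx.
have u1x : 1 + x \is a GRing.unit.
  suff /finring_linv_unit/andP[] : (1 + x) * (1 - x) = 1 by [].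
  by rewrite mulrDl mul1r mulrBr mulr1 xx subr0 subrK.
have : x \is a GRing.unit.
  have := @unitB (1 + x) 1 u1x (unitr1 _); rewrite addrC addrK; apply.
  by rewrite -subr_eq0 addrK.
by move=> ux; move: nx; rewrite -[x](mulKr ux) xx mulr0 eqxx.
Qed.

Lemma no_nilpotent x m : x ^+ m = 0 -> x = 0.
Proof.
elim: m => [|[|m] IH] xm0; [|by []|].
  by rewrite -[x]mulr1 -[1](expr0 x) xm0 mulr0.
by apply/IH/no_square_zero; rewrite -exprD addnS -addSn exprD xm0 mul0r.
Qed.

Lemma idem_comm e x : e * e = e -> e * x = x * e.
Proof.
move=> ee; have [f fE] : exists f, f = 1 - e by exists (1 - e).
have fe : f * e = 0 by rewrite fE mulrBl mul1r ee subrr.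
have ef : e * f = 0 by rewrite fE mulrBr mulr1 ee subrr.
have e_f y : y = e * y + f * y by rewrite -mulrDl fE addrC subrK mul1r.
have h1 : e * x * f = 0.
  by apply: no_square_zero; rewrite -!mulrA [f * (e * _)]mulrA fe mul0r !mulr0.
have h2 : f * x * e = 0.
  by apply: no_square_zero; rewrite -!mulrA [e * (f * _)]mulrA ef mul0r !mulr0.
rewrite [x in RHS]e_f mulrDl h2 addr0; apply/eqP; rewrite -subr_eq0.
by rewrite -[e * x in X in X - _]mulr1 -mulrBr -fE h1.
Qed.

Lemma field_or_boolean :
  (forall x, x != 0 -> x \is a GRing.unit) \/ (forall x, x * x = x).
Proof.
case: (pselect (exists e, [/\ e * e = e, e != 0 & e != 1])); last first.
  move=> noe; left=> x xn0; have [m m0 em] := finring_idem_pow x.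
  have [e0|en0] := eqVneq (x ^+ m) 0.
    by rewrite (no_nilpotent e0) eqxx in xn0.
  have [e1|en1] := eqVneq (x ^+ m) 1; last by case: noe; exists (x ^+ m).
  have /finring_linv_unit/andP[] // : x * x ^+ m.-1 = 1.
  by rewrite -exprS prednK.
case=> e [ee en0 en1]; right.
have unit1 u : u \is a GRing.unit -> u = 1.
  move=> uu; apply/eqP; apply: contraT => un1.
  have [f fE] : exists f, f = 1 - e by exists (1 - e).
  have fe : f * e = 0 by rewrite fE mulrBl mul1r ee subrr.
  have ff : f * f = f by rewrite fE idem_compl.
  have efu : u * e + f \is a GRing.unit.
    suff /finring_linv_unit/andP[] : (u * e + f) * (u^-1 * e + f) = 1 by [].
    rewrite mulrDl !mulrDr ff -[u^-1 * e](idem_comm _ ee) [f * (e * _)]mulrA fe mul0r add0r.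
    rewrite -mulrA [e * (e * _)]mulrA ee (idem_comm _ ee) mulrA mulrV // mul1r.
    have ef : e * f = 0 by rewrite fE mulrBr mulr1 ee subrr.
    by rewrite -mulrA ef mulr0 addr0 fE addrC subrK.
  have u1u := unitB uu (unitr1 R) un1.
  have d : u * e + f - 1 = (u - 1) * e.
    by rewrite fE mulrBl mul1r -addrA; congr (_ + _); rewrite addrC addrA addNr add0r.
  have [eq1|] := eqVneq (u * e + f) 1.
    move: d; rewrite eq1 subrr => /esym h.
    by move: en0; rewrite -[e](mulKr u1u) h mulr0 eqxx.
  move/(unitB efu (unitr1 R)); rewrite d unitrMr // => ue.
  by move: en1; rewrite -[e](mulKr ue) ee mulVr ?eqxx.
move=> x; have [m m0 em] := finring_idem_pow x.
have [g gE] : exists g, g = x ^+ m by exists (x ^+ m).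
rewrite -gE in em.
have xg : x * g = g * x by rewrite (idem_comm _ em).
have [f fE] : exists f, f = 1 - g by exists (1 - g).
have fg : f * g = 0 by rewrite fE mulrBl mul1r em subrr.
have gf : g * f = 0 by rewrite fE mulrBr mulr1 em subrr.
have ff : f * f = f by rewrite fE idem_compl.
have xf : x * f = f * x by rewrite (idem_comm _ ff).
have /finring_linv_unit/andP[/unit1 u1 _] : (x * g + f) * (x ^+ m.-1 * g + f) = 1.
  rewrite mulrDl !mulrDr ff -[x * g * f]mulrA gf mulr0 addr0.
  rewrite -[x ^+ m.-1 * g](idem_comm _ em) [f * (g * _)]mulrA fg mul0r add0r.
  rewrite -mulrA [g * (g * _)]mulrA em (idem_comm _ em) mulrA -exprS prednK //.
  by rewrite -gE em fE addrC subrK.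
have xgg : x * g = g by rewrite -[LHS](addrK f) u1 fE opprB addrC subrK.
have xf0 : x * f = 0.
  by apply: (@no_nilpotent _ m); rewrite exprMn_comm // -gE -(prednK m0) exprS mulrA gf mul0r.
have -> : x = g by rewrite -xgg -[LHS]mulr1 -[1](subrK g) -fE mulrDr xf0 add0r.
exact: em.
Qed.

Lemma field_or_boolean_cayley : is_field R \/ (forall x, x * x = x).
Proof.
case: field_or_boolean => [H|]; [left; split=> // x y|by right].
have dom (a b : R) : a * b = 0 -> (a == 0) || (b == 0).
  move=> ab; case: eqVneq => //= /H ua.
  by rewrite -[b](mulKr ua) ab mulr0.
exact: finDomain_mulrC dom x y.
Qed.
End Rigidity.

(** * Shellings *)

Section GraphComplex.
Variables (V : finType) (e : rel V).
Hypotheses (e_sym : ssrbool.symmetric e) (e_irr : irreflexive e).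
Implicit Types (F A : {set V}).

Lemma facets_independence : facets (independence_complex e) =i maxset (independent e).
Proof.
by move=> F; rewrite inE; apply: maxset_eq => A; rewrite inE.
Qed.

Lemma maxindep_nbr F b : maxset (independent e) F -> b \notin F ->
  exists2 a, a \in F & e b a.
Proof.
move=> /maxsetP[IF max] bF; apply: contrapT => noa.
have noa' a : a \in F -> e b a = false.
  by move=> aF; apply/negP => eba; apply: noa; exists a.
have : b |: F = F.
  apply: max; last exact: subsetUr.
  apply/forall_inP=> x; rewrite !inE => xF; apply/forall_inP=> y; rewrite !inE => yF.
  case/orP: xF yF => [/eqP->|xF] /orP[/eqP->|yF].
  - by rewrite e_irr.
  - by rewrite noa'.
  - by rewrite e_sym noa'.
  - by have /forall_inP/(_ _ xF)/forall_inP/(_ _ yF) := IF.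
by move/setP/(_ b); rewrite setU11 (negbTE bF).
Qed.

Lemma independent1 x : independent e [set x].
Proof.
by apply/forall_inP=> y /set1P->; apply/forall_inP=> z /set1P->; rewrite e_irr.
Qed.

Lemma independentS F A : A \subset F -> independent e F -> independent e A.
Proof.
move=> /subsetP AF /forall_inP IF; apply/forall_inP=> x /AF/IF/forall_inP H.
by apply/forall_inP=> y /AF/H.
Qed.

Lemma complex_of1 F A : (A \in complex_of [:: F]) = (A \subset F).
Proof. by rewrite inE /= orbF. Qed.

Lemma adjacent_private F F' : maxset (independent e) F -> independent e F' ->
  #|F| = #|F'| -> (#|F :&: F'|.+1 = #|F|)%N -> has_private_nbr e F.
Proof.
move=> MF IF' cFF' cI.
have /cards1P[b bE] : #|F' :\: F| == 1%N.
  by have := cardsID F F'; rewrite setIC; lia.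
have /cards1P[a0 aE] : #|F :\: F'| == 1%N by have := cardsID F' F; lia.
have : b \in F' :\: F by rewrite bE set11.
rewrite inE => /andP[bF bF'].
have only a : a \in F -> e b a -> a = a0.
  move=> aF eba; apply/set1P; rewrite -aE inE aF andbT.
  apply: contraL eba => aF'.
  by have /forall_inP/(_ _ bF')/forall_inP/(_ _ aF') := IF'.
have [a aF eba] := maxindep_nbr MF bF.
exists a, b; split=> // a' a'F eba'.
by rewrite (only _ aF eba) (only _ a'F eba').
Qed.

Lemma shellable_private : well_covered e -> shellable e -> (exists x y, e x y) ->
  forall F, maxset (independent e) F -> has_private_nbr e F.
Proof.
move=> wc [s [us sE pure]] [x0 [y0 exy]] F MF.
have memF A : (A \in s) = maxset (independent e) A by rewrite sE facets_independence.
have early k : (0 < k < size s)%N ->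
    exists2 j, (j < k)%N & (#|nth set0 s k :&: nth set0 s j|.+1 = #|nth set0 s k|)%N.
  move=> kP; have /andP[k0 ks] := kP.
  set D := complex_of (take k s) :&: complex_of [:: nth set0 s k].
  have D0 : set0 \in D.
    rewrite inE complex_of1 sub0set andbT inE; apply/hasP; exists (nth set0 s 0).
      by apply/(nthP set0); exists 0%N; rewrite ?size_takel ?nth_take // ltnW.
    exact: sub0set.
  have [X MX _] := maxset_exists (P := fun A : {set V} => A \in D) D0.
  have := pure k kP X; rewrite -/D inE => /(_ MX); rewrite /face_dim => cX.
  have [/setIP[]] := maxsetP MX; rewrite complex_of1 inE.
  case/hasP=> _ /(nthP set0)[j jk <-] XFj XFk maxX.
  have jk' : (j < k)%N by rewrite size_takel in jk => //; apply: ltnW.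
  exists j => //.
  rewrite nth_take // in XFj.
  suff -> : nth set0 s k :&: nth set0 s j = X by lia.
  apply: maxX; last by rewrite subsetI XFk.
  rewrite inE complex_of1 subsetIl andbT inE; apply/hasP; exists (nth set0 s j).
    by apply/(nthP set0); exists j => //; rewrite nth_take.
  exact: subsetIr.
have Fs : F \in s by rewrite memF.
have size2 : (1 < size s)%N.
  have [A MA /subsetP/(_ _ (set11 x0)) xA] := maxset_exists (independent1 x0).
  have [B MB /subsetP/(_ _ (set11 y0)) yB] := maxset_exists (independent1 y0).
  rewrite ltnNge; apply/negP => le1.
  have AB : A = B.
    case: s memF le1 {us sE pure early Fs} => [|C [|]] // memF _.
      by have := memF A; rewrite MA in_nil.
    have := memF A; have := memF B; rewrite MA MB !inE.
    by move=> /eqP-> /eqP.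
  have [/forall_inP/(_ _ xA)/forall_inP/(_ y0)] := maxsetP MA.
  by rewrite {1}AB yB exy => /(_ isT).
have [i [j [ij js cFj]]] : exists i j, [/\ (nth set0 s i = F)%N, (j < size s)%N
    & (#|F :&: nth set0 s j|.+1 = #|nth set0 s j|)%N].
  have /(nthP set0)[[|i] iS iE] := Fs.
    have [j] := early 1%N size2; rewrite ltnS leqn0 => /eqP-> c01.
    by exists 0%N, 1%N; rewrite -iE setIC.
  have [j ji cij] := early i.+1 iS.
  exists i.+1, j; split=> //; first exact: ltn_trans iS.
  rewrite -iE cij; apply: wc; rewrite -memF mem_nth //.
  exact: ltn_trans iS.
have MFj : maxset (independent e) (nth set0 s j) by rewrite -memF mem_nth.
have cE := wc _ _ MF MFj.
by have [IFj _] := maxsetP MFj; apply: (adjacent_private MF IFj cE); rewrite cFj cE.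
Qed.
End GraphComplex.

Section ClusterGraph.
Variables (V C : finType) (c : V -> C) (e : rel V).
Hypothesis eE : forall x y, e x y = (x != y) && (c x == c y).
Implicit Types (F A : {set V}).

Lemma cluster_independentP A :
  reflect {in A &, injective c} (independent e A).
Proof.
apply: (iffP forall_inP) => [H x y xA yA cxy|inj x xA].
  apply: contraTeq isT => nxy.
  by have /forall_inP/(_ y yA) := H x xA; rewrite eE nxy cxy eqxx.
apply/forall_inP=> y yA; rewrite eE negb_and negbK.
by case: eqVneq => //= nxy; apply: contraNneq nxy => /inj->.
Qed.

Lemma cluster_independent_card A : independent e A -> (#|A| <= #|codom c|)%N.
Proof.
move=> /cluster_independentP inj; rewrite -(card_in_imset inj).
by apply/subset_leq_card/subsetP=> _ /imsetP[x _ ->]; apply: codom_f.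
Qed.

Lemma cluster_facetP F :
  reflect (independent e F /\ forall v, exists2 w, w \in F & c w = c v)
          (maxset (independent e) F).
Proof.
apply: (iffP idP) => [MF|[IF sur]].
  have [IF _] := maxsetP MF; split=> // v.
  have [vF|vF] := boolP (v \in F); first by exists v.
  have e_sym : ssrbool.symmetric e by move=> x y; rewrite !eE eq_sym [c x == _]eq_sym.
  have e_irr : irreflexive e by move=> x; rewrite eE eqxx.
  have [a aF] := maxindep_nbr e_sym e_irr MF vF.
  by rewrite eE => /andP[_ /eqP cv]; exists a.
apply/maxsetP; split=> // B /cluster_independentP IB /subsetP sFB.
apply/setP=> v; apply/idP/idP => [vB|/sFB//].
by have [w wF cw] := sur v; rewrite -(IB w v _ vB cw) // sFB.
Qed.

Lemma cluster_facet_card F : maxset (independent e) F -> #|F| = #|codom c|.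
Proof.
case/cluster_facetP=> /cluster_independentP inj sur.
rewrite -(card_in_imset inj); apply: eq_card => z.
apply/imsetP/codomP => [[x _ ->]|[v ->]]; first by exists x.
by have [w wF cw] := sur v; exists w.
Qed.

Lemma cluster_well_covered : well_covered e.
Proof. by move=> A B /cluster_facet_card-> /cluster_facet_card->. Qed.

(* Ordering the facets by total rank gives a shelling: if [F'] does not come
   after [F], then exchanging some vertex [w] of [F] for the smaller vertex of
   [F'] in the same clique gives a facet that precedes [F] and contains
   [F :\ w]. *)
Let weight F := (\sum_(v in F) enum_rank v)%N.

Let weight_exchange F F' : maxset (independent e) F -> maxset (independent e) F' ->
  F != F' -> (weight F' <= weight F)%N ->
  exists w F'', [/\ w \in F, w \notin F', maxset (independent e) F'',
    F :\ w \subset F'' & (weight F'' < weight F)%N].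
Proof.
move=> MF MF' nFF' wle.
have [/cluster_independentP IF sF] := cluster_facetP _ MF.
have [/cluster_independentP IF' sF'] := cluster_facetP _ MF'.
have ex v : exists w, w \in F' /\ c w = c v by have [w wF' cw] := sF' v; exists w.
have [g gP] := choice ex.
have imF : [set g v | v in F] = F'.
  apply/setP=> w; apply/imsetP/idP => [[v _ ->]|wF']; first by case: (gP v).
  have [v vF cv] := sF w; exists v => //; have [gF cg] := gP v.
  by apply: IF'; rewrite ?cg.
have gi : {in F &, injective g}.
  by move=> x y xF yF gxy; apply: IF => //; rewrite -(gP x).2 gxy (gP y).2.
have wE : weight F' = (\sum_(v in F) enum_rank (g v))%N by rewrite /weight -imF big_imset.
have [w wF lt_w] : exists2 w, w \in F & (enum_rank (g w) < enum_rank w)%N.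
  apply: contrapT => H.
  have le v : v \in F -> (enum_rank v <= enum_rank (g v))%N.
    by move=> vF; rewrite leqNgt; apply/negP => lt; apply: H; exists v.
  case/eqP: nFF'; rewrite -imF -[LHS]imset_id; apply: eq_in_imset => v vF.
  have : (enum_rank v == enum_rank (g v) :> nat).
    have := leqif_sum (fun v vF => leqif_eq (le v vF)).
    rewrite -wE => -[le' /esym].
    by rewrite eqn_leq le' wle => /forall_inP; apply.
  by move/eqP/val_inj/enum_rank_inj.
have gwF : g w \notin F.
  apply: contraL lt_w => gwF; rewrite -leqNgt.
  by rewrite (IF (g w) w) // (gP w).2.
exists w, (g w |: F :\ w); split=> //.
- apply/negP=> wF'; move: lt_w; rewrite (IF' (g w) w) ?ltnn //; by case: (gP w).
- apply/cluster_facetP; split.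
    apply/cluster_independentP=> x y; rewrite !inE.
    case/orP=> [/eqP->|/andP[xw xF]] /orP[/eqP->|/andP[yw yF]] //.
    + by rewrite (gP w).2 => /IF wy; rewrite (wy wF yF) eqxx in yw.
    + by rewrite (gP w).2 => /IF wx; rewrite (wx xF wF) eqxx in xw.
    + exact: IF.
  move=> v; have [u uF cu] := sF v.
  have [uw|uw] := eqVneq u w.
    by exists (g w); rewrite ?setU11 // (gP w).2 -uw.
  by exists u; rewrite // !inE uw uF orbT.
- exact: subsetUr.
- rewrite /weight big_setU1 ?inE ?(negbTE gwF) ?andbF //=.
  by rewrite (big_setD1 w wF) /= ltn_add2r.
Qed.

Lemma cluster_shellable : shellable e.
Proof.
pose leW := relpre weight leq.
have leW_total : total leW by move=> A B; apply: leq_total.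
have leW_trans : transitive leW by move=> A B D; apply: leq_trans.
exists (sort leW (enum (facets (independence_complex e)))); split.
- by rewrite sort_uniq enum_uniq.
- by move=> F; rewrite mem_sort mem_enum.
set s := sort _ _.
have memF A : (A \in s) = maxset (independent e) A.
  by rewrite mem_sort mem_enum facets_independence.
have us : uniq s by rewrite sort_uniq enum_uniq.
move=> i /andP[i0 iS]; set F := nth set0 s i.
have MF : maxset (independent e) F by rewrite -memF mem_nth.
move=> X; rewrite inE => /maxsetP[/setIP[]].
rewrite complex_of1 inE => /hasP[F' F's XF'] XF maxX.
have F's' : F' \in s by apply: mem_take F's.
have ltj : (index F' s < i)%N by rewrite -in_take.
have MF' : maxset (independent e) F' by rewrite -memF.
have leW_sorted := sorted_leq_nth leW_trans (fun A => leqnn _) set0 (sort_sorted leW_total _).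
have wle : (weight F' <= weight F)%N.
  rewrite -(nth_index set0 F's').
  by apply: leW_sorted; rewrite ?inE ?index_mem // ltnW.
have nFF' : F != F'.
  by apply: contraL ltj => /eqP <-; rewrite index_uniq // ltnn.
have [w [F'' [wF wF' MF'' sub lt]]] := weight_exchange MF MF' nFF' wle.
have -> : X = F :\ w.
  apply/esym/maxX; last first.
    by rewrite subsetD1 XF; apply: contra wF'; apply: (subsetP XF').
  rewrite inE complex_of1 subD1set andbT inE; apply/hasP; exists F'' => //.
  have F''s : F'' \in s by rewrite memF.
  rewrite in_take // ltnNge; apply: contraL lt => lei; rewrite -leqNgt.
  rewrite -(nth_index set0 F''s).
  by apply: leW_sorted; rewrite ?inE ?index_mem.
by rewrite /face_dim (cardsD1 w F) wF addnC PoszD addrK.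
Qed.
End ClusterGraph.

Lemma field_cluster (R : finUnitRingType) : is_field R ->
  forall x y : R, unitary_cayley x y = (x != y) && (tt == tt).
Proof.
move=> [_ H] x y; rewrite /unitary_cayley /= andbT.
by case: eqVneq => //= nxy; rewrite H // subr_eq0.
Qed.

Lemma Z2_power_cluster (R : finUnitRingType) k : is_Z2_power R k ->
  forall x y : R, unitary_cayley x y =
    (x != y) && ([set x; x + 1] == [set y; y + 1]).
Proof.
move=> [f [g fK gK]].
have Z2_cases (a : 'Z_2) : a = 0 \/ a = 1.
  by case: a => [[|[|//]] lt]; [left|right]; apply: val_inj.
have char2 : 1 + 1 = 0 :> R.
  apply: (can_inj fK); rewrite rmorphD rmorph1 rmorph0.
  by apply/ffunP=> i; rewrite !ffunE; apply: val_inj.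
have unit1 (x : R) : x \is a GRing.unit -> x = 1.
  move=> ux; apply: (can_inj fK); rewrite rmorph1; apply/ffunP=> i.
  have := congr1 (fun h : {ffun 'I_k -> 'Z_2} => h i) (congr1 f (mulrV ux)).
  rewrite rmorphM rmorph1 !ffunE.
  by case: (Z2_cases (f x i)) => -> //; rewrite mul0r => /(congr1 val).
move=> x y; rewrite /unitary_cayley /=; case: eqVneq => //= nxy.
have addK (z : R) : z + 1 + 1 = z by rewrite -addrA char2 addr0.
apply/idP/eqP => [/unit1 xy1|/setP/(_ x)].
  have -> : x = y + 1 by rewrite -xy1 addrC subrK.
  by rewrite addK setUC.
rewrite !inE eqxx (negbTE nxy) /= => /esym/eqP->.
by rewrite addrC addKr unitr1.
Qed.

(** * Finite Boolean rings *)

Section BooleanRing.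
Variable R : finUnitRingType.
Hypothesis sqx : forall x : R, x * x = x.
Implicit Types x y : R.

Lemma boolean_char2 x : x + x = 0.
Proof.
have := sqx (x + x); rewrite mulrDl !mulrDr !sqx => /eqP.
by rewrite -subr_eq0 addrK => /eqP.
Qed.

Lemma boolean_comm x y : x * y = y * x.
Proof.
have := sqx (x + y); rewrite mulrDl !mulrDr !sqx -addrA.
move/addrI; rewrite addrA -[RHS]add0r => /addIr xy.
by rewrite -[LHS]addr0 -(boolean_char2 (y * x)) addrA xy add0r.
Qed.

Definition atom x : bool := (x != 0) && [forall y, (y * x == 0) || (y * x == x)].

Lemma atomP x y : atom x -> y * x = 0 \/ y * x = x.
Proof. by case/andP=> _ /forallP/(_ y)/orP[]/eqP; [left|right]. Qed.

Lemma atom_orth x y : atom x -> atom y -> x != y -> x * y = 0.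
Proof.
move=> ax ay nxy; case: (atomP x ay) => // xy.
case: (atomP y ax) => yx; first by rewrite boolean_comm.
by rewrite -xy boolean_comm yx eqxx in nxy.
Qed.

Lemma atom_below x : x != 0 -> exists2 a, atom a & x * a = a.
Proof.
have [n] := ubnP #|[set y * x | y : R]|; elim: n x => // n IH x; rewrite ltnS => len xn0.
have [ax|] := boolP (atom x); first by exists x.
rewrite /atom xn0 => /forallPn[y]; rewrite negb_or => /andP[yx0 yxx].
have [] := IH (y * x) _ yx0.
  apply: leq_trans len; apply/proper_card/properP; split.
    by apply/subsetP=> _ /imsetP[z _ ->]; apply/imsetP; exists (z * y); rewrite ?mulrA.
  exists x; first by apply/imsetP; exists 1; rewrite ?mul1r.
  apply/imsetP=> -[z _ xz]; case/eqP: yxx.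
  by rewrite {1}xz !mulrA [y * z]boolean_comm -!mulrA [y * (y * x)]mulrA sqx -xz.
move=> a aa yxa; exists a => //.
by rewrite -yxa !mulrA [x * y]boolean_comm -[y * x * x]mulrA sqx.
Qed.

Local Notation k := #|[set x | atom x]|.
Local Notation at_ i := (enum_val (i : 'I_k)).

Definition atoms_in x : {ffun 'I_k -> 'Z_2} := [ffun i => (x * at_ i == at_ i)%:R].

Lemma at_atom (i : 'I_k) : atom (at_ i).
Proof. by have := enum_valP i; rewrite inE. Qed.

Lemma at_neq0 (i : 'I_k) : at_ i != 0.
Proof. by case/andP: (at_atom i). Qed.

Lemma atoms_in_zmod_morphism : zmod_morphism atoms_in.
Proof.
move=> x y; apply/ffunP=> i; rewrite !ffunE mulrBl.
have n0 := negbTE (at_neq0 i); have n0' : (0 == at_ i) = false by rewrite eq_sym.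
have Na : - at_ i = at_ i by apply/eqP; rewrite eq_sym -subr_eq0 opprK boolean_char2.
case: (atomP x (at_atom i)) => ->; case: (atomP y (at_atom i)) => ->;
  rewrite ?subr0 ?subrr ?sub0r ?Na ?eqxx ?n0' ?subr0 ?subrr //.
by apply: val_inj.
Qed.

Lemma atoms_in_monoid_morphism : monoid_morphism atoms_in.
Proof.
split=> [|x y]; apply/ffunP=> i; rewrite !ffunE ?mul1r ?eqxx // -mulrA.
have n0' : (0 == at_ i) = false by rewrite eq_sym (negbTE (at_neq0 i)).
case: (atomP y (at_atom i)) => ->; first by rewrite mulr0 n0' mulr0.
by rewrite eqxx mulr1.
Qed.

HB.instance Definition _ :=
  GRing.isZmodMorphism.Build R {ffun 'I_k -> 'Z_2} atoms_in atoms_in_zmod_morphism.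
HB.instance Definition _ :=
  GRing.isMonoidMorphism.Build R {ffun 'I_k -> 'Z_2} atoms_in atoms_in_monoid_morphism.

Lemma boolean_Z2_power : exists n, (0 < n)%N /\ is_Z2_power R n.
Proof.
exists k; split.
  have [a aa _] := atom_below (oner_neq0 R).
  by apply/card_gt0P; exists a; rewrite inE.
exists atoms_in.
pose g (h : {ffun 'I_k -> 'Z_2}) := \sum_(i | h i == 1) at_ i.
exists g.
  move=> x; apply/eqP; rewrite -subr_eq0; apply: contraT => /atom_below[a aa].
  have /esym : a \in [set x | atom x] by rewrite inE.
  move/esym => aA.
  set i := enum_rank_in aA a.
  have ai : a = at_ i by rewrite enum_rankK_in.
  rewrite mulrBl.
  have -> : g (atoms_in x) * a = x * a.
    rewrite /g mulr_suml.
    have [xa|xa] := eqVneq (x * a) a.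
      rewrite xa (bigD1 i) /=; last by rewrite ffunE -ai xa eqxx.
      rewrite big1 ?addr0 -?ai // => j /andP[_ ji].
      by rewrite ai atom_orth ?at_atom // (inj_eq enum_val_inj).
    rewrite big1; first by case: (atomP x aa) => // xa'; rewrite xa' eqxx in xa.
    move=> j; rewrite ffunE => ja; have [ij|ij] := eqVneq j i.
      by rewrite ij -ai (negbTE xa) in ja.
    by rewrite ai atom_orth ?at_atom // (inj_eq enum_val_inj).
  by rewrite subrr => a0; case/andP: aa; rewrite -a0 eqxx.
move=> h; apply/ffunP=> i; rewrite ffunE /g mulr_suml.
have n0' : (0 == at_ i) = false by rewrite eq_sym (negbTE (at_neq0 i)).
have hi : h i = (h i == 1)%:R.
  by case: (h i) => [[|[|//]] lt]; apply: val_inj.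
rewrite [RHS]hi; have [h1|h1] := boolP (h i == 1).
  rewrite (bigD1 i) //= sqx big1 ?addr0 ?eqxx // => j /andP[_ ji].
  by rewrite atom_orth ?at_atom // (inj_eq enum_val_inj).
rewrite big1 ?n0' // => j hj; rewrite atom_orth ?at_atom // (inj_eq enum_val_inj).
by apply: contraNneq h1 => <-.
Qed.
End BooleanRing.

(** * Noetherian rings, prime ideals and regular sequences *)

Lemma seq_rec (T : Type) (next : seq T -> T) :
  exists a : nat -> T, forall n, a n = next (mkseq a n).
Proof.
pose l := fix l n := if n is n'.+1 then rcons (l n') (next (l n')) else [::].
exists (fun n => next (l n)) => n; congr next.
by elim: n => // n IH; rewrite /= {1}IH -mkseqS.
Qed.

Section Ideals.
Variable A : comNzRingType.
Implicit Types (I S : A -> Prop) (xs l : seq A) (P : {pred A}).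

Fixpoint lspan l (y : A) : Prop :=
  if l is a :: l' then exists c y', lspan l' y' /\ y = c * a + y' else y = 0.

Lemma lspanP l y :
  lspan l y <-> exists c : nat -> A, y = \sum_(i < size l) c i * l`_i.
Proof.
elim: l y => [|a l IH] y /=.
  by split=> [->|[c]]; [exists (fun=> 0)|]; rewrite big_ord0.
split=> [[c [y' [/IH[d ->] ->]]]|[c ->]].
  exists (fun i => if i is i'.+1 then d i' else c).
  by rewrite big_ord_recl.
exists (c 0%N), (\sum_(i < size l) c i.+1 * l`_i); split; last by rewrite big_ord_recl.
by apply/IH; exists (fun i => c i.+1).
Qed.

Lemma ideal_spanP l y : reflect (lspan l y) (y \in ideal_span l).
Proof. by apply: (iffP (asboolP _)); rewrite lspanP. Qed.

Definition is_ideal I := I 0 /\ forall a u v, I u -> I v -> I (a * u + v).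

Section IsIdeal.
Variable I : A -> Prop.
Hypothesis II : is_ideal I.
Lemma ideal0 : I 0. Proof. by case: II. Qed.
Lemma idealM a u : I u -> I (a * u).
Proof. by move=> Iu; rewrite -[_ * _]addr0; apply: II.2 => //; apply: ideal0. Qed.
Lemma idealD u v : I u -> I v -> I (u + v).
Proof. by move=> Iu Iv; rewrite -[u]mul1r; apply: II.2. Qed.
Lemma idealN u : I u -> I (- u).
Proof. by move=> Iu; rewrite -mulN1r; apply: idealM. Qed.
Lemma idealB u v : I u -> I v -> I (u - v).
Proof. by move=> Iu Iv; apply: idealD => //; apply: idealN. Qed.
Lemma lspan_ideal l y : (forall x, x \in l -> I x) -> lspan l y -> I y.
Proof.
elim: l y => [|a l IH] y /= H; first by move=> ->; apply: ideal0.
case=> c [y' [Hy' ->]]; apply: II.2; first by apply: H; rewrite mem_head.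
by apply: IH Hy' => x xl; apply: H; rewrite inE xl orbT.
Qed.
End IsIdeal.

Lemma lspan_is_ideal l : is_ideal (lspan l).
Proof.
elim: l => [|a l IH]; first by split=> // a u v -> ->; rewrite mulr0 addr0.
split=> [|b u v [c [u' [Hu ->]]] [d [v' [Hv ->]]]].
  by exists 0, 0; split; [apply: ideal0|rewrite mul0r addr0].
by exists (b * c + d), (b * u' + v'); split; [apply: IH.2|ring].
Qed.

Lemma mem_lspan l x : x \in l -> lspan l x.
Proof.
elim: l => // a l IH; rewrite inE => /orP[/eqP->|/IH H] /=.
  by exists 1, 0; split; [apply: ideal0 (lspan_is_ideal _)|ring].
by exists 0, x; split; last ring.
Qed.

Lemma lspan_sub l l' y : {subset l <= l'} -> lspan l y -> lspan l' y.
Proof.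
move=> sub; apply: lspan_ideal; first exact: lspan_is_ideal.
by move=> x /sub; apply: mem_lspan.
Qed.

Lemma idealr_is_ideal P : idealr_closed P -> is_ideal (fun x => x \in P).
Proof. by case=> P0 _ PD; split=> // a u v uP vP; apply: PD. Qed.

Definition noeth := forall a : nat -> A, exists N, lspan (mkseq a N) (a N).

Lemma noeth_fg I : noeth -> is_ideal I ->
  exists l, (forall x, x \in l -> I x) /\ (forall y, I y -> lspan l y).
Proof.
move=> NA II; apply: contrapT => nofg.
have ex l : exists x, (forall x, x \in l -> I x) -> I x /\ ~ lspan l x.
  apply: contrapT => nox; apply: nofg; exists l.
  split.
    apply: contrapT => Hl; apply: nox; exists 0 => lI; by case: Hl.
  move=> y Iy; apply: contrapT => nly; apply: nox; exists y; by split.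
have [next nextP] := choice ex.
have [a aE] := seq_rec next.
have aI n : forall x, x \in mkseq a n -> I x.
  elim: n => // n IH x; rewrite mkseqS mem_rcons inE => /orP[/eqP->|]; last exact: IH.
  by rewrite aE; case: (nextP _ IH).
have [N HN] := NA a.
by case: (nextP _ (aI N)) => _; rewrite -aE.
Qed.

Lemma noeth_noetherian : noeth -> noetherian A.
Proof.
move=> NA J /idealr_is_ideal JI; have [l [lJ Jl]] := noeth_fg NA JI; exists l => y.
by apply/idP/ideal_spanP; [apply: Jl|apply: lspan_ideal lJ].
Qed.

Lemma noeth_maximal (Phi : (A -> Prop) -> Prop) I : noeth -> Phi I ->
  (forall I, Phi I -> is_ideal I) ->
  exists J, [/\ Phi J, forall x, I x -> J x &
    forall J', Phi J' -> (forall x, J x -> J' x) -> forall x, J' x -> J x].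
Proof.
move=> NA PI PhiI; apply: contrapT => nomax.
pose T := {J : A -> Prop | Phi J /\ forall x, I x -> J x}.
have ex (J : T) : exists J'x : T * A, [/\ forall x, sval J x -> sval J'x.1 x,
    sval J'x.1 J'x.2 & ~ sval J J'x.2].
  case: J => J [PJ IJ] /=; apply: contrapT => noJ; apply: nomax.
  exists J; split=> // J' PJ' JJ' x J'x; apply: contrapT => nJx; apply: noJ.
  have hJ' : Phi J' /\ forall x, I x -> J' x by split=> // y /IJ/JJ'.
  by exists (exist _ J' hJ', x); split.
have [f fP] := choice ex.
pose T0 : T := exist _ I (conj PI (fun x Ix => Ix)).
pose seqT n : T := iter n (fun J => (f J).1) T0.
have mono n k x : sval (seqT n) x -> sval (seqT (k + n)%N) x.
  elim: k => // k IH /IH; rewrite addSn /=.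
  by case: (fP (seqT (k + n)%N)) => H _ _; apply: H.
have [N HN] := NA (fun n => (f (seqT n)).2).
case: (fP (seqT N)) => _ _; apply; apply: lspan_ideal HN.
  by apply: PhiI; case: (svalP (seqT N)).
move=> z /mapP[k]; rewrite mem_iota add0n /= => kN ->.
rewrite -(subnK kN).
by apply: mono; case: (fP (seqT k)).
Qed.

Lemma prime_disjoint I S : noeth -> is_ideal I ->
  S 1 -> (forall x y, S x -> S y -> S (x * y)) -> (forall x, I x -> ~ S x) ->
  exists P, [/\ prime_ideal P, forall x, I x -> x \in P & forall x, x \in P -> ~ S x].
Proof.
move=> NA II S1 SM IS.
have [] := @noeth_maximal (fun J => is_ideal J /\ forall x, J x -> ~ S x) I NA.
- by [].
- by move=> J [].
move=> J [[IJ JS] sIJ max]; exists (fun x => `[< J x >]); split; last 2 first.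
- by move=> x Ix; apply/asboolP/sIJ.
- by move=> x /asboolP/JS.
have plus u : ~ J u -> exists j a, J j /\ S (j + a * u).
  move=> nJu; apply: contrapT => noS; apply: nJu.
  apply: (max (fun x => exists j a, J j /\ x = j + a * u)).
  - split; first split.
    + by exists 0, 0; split; [apply: ideal0|ring].
    + move=> b _ _ [j [a [Jj ->]]] [j' [a' [Jj' ->]]].
      by exists (b * j + j'), (b * a + a'); split; [apply: IJ.2|ring].
    + by move=> x [j [a [Jj ->]]] Sx; apply: noS; exists j, a.
  - by move=> x Jx; exists x, 0; split=> //; ring.
  - by exists 0, 1; split; [apply: ideal0|ring].
split; first split.
- by apply/asboolP; apply: ideal0.
- by apply/negP=> /asboolP/JS.
- by move=> a u v /asboolP Ju /asboolP Jv; apply/asboolP; apply: IJ.2.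
move=> u v /asboolP Juv; apply/orP; apply: contrapT => /not_orP[nu nv].
have /plus[j [a [Jj Sj]]] : ~ J u by move/asboolP.
have /plus[k [b [Jk Sk]]] : ~ J v by move/asboolP.
apply: (JS _ _ (SM _ _ Sj Sk)).
have -> : (j + a * u) * (k + b * v) = (k + b * v) * j + (a * u * k + a * b * (u * v)).
  by ring.
by apply: IJ.2 => //; apply: IJ.2 => //; apply: idealM.
Qed.

Section Prime.
Variable P : {pred A}.
Hypothesis PP : prime_ideal P.
Let PI := idealr_is_ideal PP.1.
Lemma prime1 : 1 \notin P. Proof. by case: PP => [[]]. Qed.
Lemma primeM u v : (u * v \in P) = (u \in P) || (v \in P).
Proof.
apply/idP/orP => [uv|[]]; first by apply/orP/PP.2.
  by move=> uP; rewrite mulrC; apply: (idealM PI).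
exact: (idealM PI).
Qed.
Lemma primeX u n : u ^+ n \in P -> u \in P.
Proof.
elim: n => [|n IH]; first by rewrite expr0 (negbTE prime1).
by rewrite exprS primeM => /orP[].
Qed.
Lemma primeDr u v : v \in P -> (u + v \in P) = (u \in P).
Proof.
move=> vP; apply/idP/idP => uP; last exact: (idealD PI).
by rewrite -[u](addrK v); apply: (idealB PI).
Qed.
End Prime.

Lemma regular_prime_chain xs P : noeth -> regular_sequence xs ->
  prime_ideal P -> {subset xs <= P} -> exists Q, prime_chain_to P (size xs) Q.
Proof.
move=> NA [reg _] PP sub.
suff H i : (i <= size xs)%N -> forall P, prime_ideal P ->
    (forall j, (j < i)%N -> xs`_j \in P) -> exists Q, prime_chain_to P i Q.
  by apply: (H _ (leqnn _)) => // j jS; apply/sub/mem_nth.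
elim: i {P PP sub} => [|i IH] iS P PP sub.
  by exists (fun=> P); split=> // j.
pose S z := exists s k, s \notin P /\ z = s * xs`_i ^+ k.
have [||||P' [PP' IP' P'S]] := @prime_disjoint (lspan (take i xs)) S NA.
- exact: lspan_is_ideal.
- by exists 1, 0%N; rewrite prime1 //; split=> //; ring.
- move=> _ _ [s [k [sP ->]]] [t [l [tP ->]]].
  exists (s * t), (k + l)%N; rewrite primeM // negb_or sP tP; split=> //.
  by rewrite exprD; ring.
- move=> z + [s [k [sP zE]]]; rewrite {}zE.
  have red : lspan (take i xs) (s * xs`_i ^+ k) -> lspan (take i xs) s.
    elim: k => [|k IHk]; first by rewrite expr0 mulr1.
    rewrite exprS mulrCA => /ideal_spanP H; apply: IHk; apply/ideal_spanP.
    exact: reg H.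
  move=> /red ls; case/negP: sP; apply: (lspan_ideal (idealr_is_ideal PP.1) _ ls).
  move=> x /(nthP 0)[j]; rewrite (size_takel (ltnW iS)) => ji <-.
  by rewrite nth_take // sub // ltnW.
have sP'P : {subset P' <= P}.
  move=> z zP'; apply: contrapT => /negP zP; apply: (P'S z zP').
  by exists z, 0%N; split=> //; ring.
have xP' : xs`_i \notin P'.
  apply/negP=> /P'S; apply; exists 1, 1%N; rewrite prime1 //; split=> //; ring.
have [j ji|Q [Qp Qs QP']] := IH (ltnW iS) P' PP'.
  apply: IP'; apply: mem_lspan; rewrite -(nth_take 0 ji) mem_nth //.
  by rewrite size_takel // ltnW.
exists (fun n => if (n <= i)%N then Q n else P); split.
- by move=> j _; case: leqP => // ji; apply: Qp.
- move=> j jS; have /orP[/eqP{jS}->|ji] : (j == i) || (j < i)%N by rewrite -leq_eqVlt.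
    rewrite leqnn ltnn; split=> [x|]; first by rewrite QP'; apply: sP'P.
    by move=> /(_ xs`_i (sub _ (ltnSn _))); rewrite QP' (negbTE xP').
  by rewrite ji (ltnW ji); apply: Qs.
- by rewrite ltnn.
Qed.
End Ideals.

Section LexNonzero.
Variable A : comNzRingType.
Implicit Types (I S : A -> Prop) (xs l : seq A) (P : {pred A}).

(* The shape of the value at [xs] of a nonzero polynomial over a field, seen
   from its lexicographically smallest monomial. *)
Fixpoint lexnz xs (y : A) : Prop :=
  if xs is x :: xs' then exists n y0 w, lexnz xs' y0 /\ y = x ^+ n * (y0 + x * w)
  else exists z, z * y = 1.

Lemma lexnzM xs y z : lexnz xs y -> lexnz xs z -> lexnz xs (y * z).
Proof.
elim: xs y z => [|x xs IH] y z /=.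
  by move=> [y' yy] [z' zz]; exists (y' * z'); rewrite mulrACA yy zz mulr1.
move=> [n [y0 [w [Hy ->]]]] [k [z0 [v [Hz ->]]]].
exists (n + k)%N, (y0 * z0), (y0 * v + w * z0 + x * w * v); split; first exact: IH.
by rewrite exprD; ring.
Qed.

Lemma lexnz_cons x xs y : lexnz xs y -> lexnz (x :: xs) y.
Proof. by move=> Hy; exists 0%N, y, 0; split=> //; ring. Qed.

Lemma lexnz1 xs : lexnz xs 1.
Proof. by elim: xs => [|x xs IH]; [exists 1; rewrite mulr1|apply: lexnz_cons]. Qed.

Lemma prime_chain_lexnz r (Q : nat -> {pred A}) :
  (forall i, (i <= r)%N -> prime_ideal (Q i)) ->
  (forall i, (i < r)%N -> {subset Q i <= Q i.+1} /\ ~ {subset Q i.+1 <= Q i}) ->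
  exists2 xs, size xs = r & forall y, lexnz xs y -> y \notin Q 0%N.
Proof.
elim: r Q => [|r IH] Q Qp Qs.
  exists [::] => // y [z zy]; apply/negP=> yQ.
  have := prime1 (Qp 0%N isT); rewrite -zy primeM ?yQ ?orbT //; exact: Qp.
have [i ir|i ir|xs sxs Hxs] := IH (fun i => Q i.+1).
- exact: Qp.
- exact: Qs.
have Q0 := Qp 0%N isT; have Q1 := Qp 1%N isT.
have [s01 n10] := Qs 0%N isT.
have [x xQ1 xQ0] : exists2 x, x \in Q 1%N & x \notin Q 0%N.
  apply: contrapT => nox; apply: n10 => x xQ1; apply: contraT => xQ0.
  by exfalso; apply: nox; exists x.
exists (x :: xs); first by rewrite /= sxs.
move=> y [n [y0 [w [/Hxs y0Q1 ->]]]]; rewrite primeM // negb_or.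
apply/andP; split; first by apply: contra xQ0; apply: primeX.
apply: contra y0Q1 => /s01; rewrite primeDr // primeM //.
by rewrite xQ1.
Qed.

Section Local.
Hypothesis NA : noeth A.
Variable m : {pred A}.
Hypothesis mP : prime_ideal m.

(* The contraction to the ring of the localization of [I] at [m]. *)
Definition sat I (z : A) : Prop := exists2 s, s \notin m & I (s * z).

Lemma sat_in I z : I z -> sat I z.
Proof. by move=> Iz; exists 1; rewrite ?mul1r // prime1. Qed.

Lemma sat_sat I z : sat (sat I) z -> sat I z.
Proof.
move=> [s sm [t tm Itsz]]; exists (t * s); last by rewrite -mulrA.
by rewrite primeM // negb_or tm.
Qed.

Lemma sat_ideal I : is_ideal I -> is_ideal (sat I).
Proof.
move=> II; split; first by apply: sat_in; apply: ideal0.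
move=> a u v [s sm Isu] [t tm Itv]; exists (s * t); first by rewrite primeM // negb_or sm.
have -> : s * t * (a * u + v) = (t * a) * (s * u) + s * (t * v) by ring.
by apply: II.2 => //; apply: idealM.
Qed.

Definition addI I x := fun z => exists2 a, I (z - x * a) & True.

Lemma addI_ideal I x : is_ideal I -> is_ideal (addI I x).
Proof.
move=> II; split; first by exists 0 => //; rewrite mulr0 subr0; apply: ideal0.
move=> b u v [a Ia _] [c Ic _]; exists (b * a + c) => //.
have -> : b * u + v - x * (b * a + c) = b * (u - x * a) + (v - x * c) by ring.
exact: II.2.
Qed.

Lemma nakayama I S x : is_ideal I -> is_ideal S -> x \in m ->
  (forall a, S a -> exists s a', [/\ s \notin m, S a' & I (s * a - x * a')]) ->
  forall a, S a -> sat I a.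
Proof.
move=> II IS xm H a Sa; have [l [lS Sl]] := noeth_fg NA IS.
have IsI := sat_ideal II.
apply: (lspan_ideal IsI) (Sl a Sa).
have {H Sl lS} : forall b, b \in l -> exists s c, [/\ s \notin m, lspan l c & I (s * b - x * c)].
  move=> b /lS/H[s [c [sm Sc Ic]]]; exists s, c; split=> //; exact: Sl.
elim: l => // a0 l IH H.
have [s [_ [sm [c [y [ly ->]]] Is]]] := H a0 (mem_head _ _).
have nm : s - x * c \notin m.
  rewrite primeDr // -mulrN primeM // xm //.
have Hl b : b \in l -> sat I b.
  apply: IH => b' b'l.
  have [|t [_ [tm [d [z [lz ->]]] It]]] := H b'; first by rewrite inE b'l orbT.
  exists ((s - x * c) * t), (d * x * y + (s - x * c) * z); split.
  - by rewrite primeM // negb_or nm.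
  - have [_ lD] := lspan_is_ideal l; apply: lD => //.
    by apply: idealM => //; apply: lspan_is_ideal.
  - have -> : (s - x * c) * t * b' - x * (d * x * y + (s - x * c) * z) =
      (s - x * c) * (t * b' - x * (d * a0 + z)) + (x * d) * (s * a0 - x * (c * a0 + y)).
      by ring.
    by apply: II.2 => //; apply: idealM.
move=> b; rewrite inE => /orP[/eqP->|]; last exact: Hl.
apply: sat_sat; exists (s - x * c) => //.
have -> : (s - x * c) * a0 = (s * a0 - x * (c * a0 + y)) + x * y by ring.
apply: idealD => //; first exact: sat_in.
by apply: idealM => //; apply: lspan_ideal ly.
Qed.

Fixpoint regular_mod I xs : Prop :=
  if xs is x :: xs' then
    [/\ x \in m, forall a, sat I (x * a) -> sat I a & regular_mod (addI I x) xs']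
  else True.

Lemma regular_lexnz I xs y z : is_ideal I -> regular_mod I xs -> lexnz xs y ->
  sat I (y * z) -> sat I z.
Proof.
elim: xs I y z => [|x xs IH] I y z II /=.
  move=> _ [y' yy] /(idealM (sat_ideal II) y'); by rewrite mulrA yy mul1r.
move=> [xm xreg reg] [k [y0 [w [Hy0 ->]]]].
have SI := sat_ideal II.
have xk j b : sat I (x ^+ j * b) -> sat I b.
  elim: j => [|j IHj]; first by rewrite expr0 mul1r.
  by rewrite exprS -mulrA => /xreg.
rewrite -mulrA => /xk Sz.
apply/sat_sat/(@nakayama (sat I) (fun z => sat I ((y0 + x * w) * z)) x) => //.
  split; first by rewrite mulr0; apply: ideal0.
  move=> a u v Hu Hv; rewrite mulrDr mulrCA; exact: SI.2.
move=> a Sa.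
have : sat (addI I x) (y0 * a).
  have [s sm Is] := Sa; exists s => //; exists (- (s * w * a)) => //.
  by have -> : s * (y0 * a) - x * - (s * w * a) = s * ((y0 + x * w) * a) by ring.
move=> /(IH _ _ _ (addI_ideal x II) reg Hy0)[s sm [a' Ia' _]].
exists s, a'; split=> //; last exact: sat_in.
apply: xreg.
have -> : x * ((y0 + x * w) * a') =
   s * ((y0 + x * w) * a) + (- (y0 + x * w)) * (s * a - x * a') by ring.
by apply: SI.2 => //; apply: idealM => //; apply: sat_in.
Qed.

(* If the fraction [a / g] has denominators [h] not involving [x], for each
   [x] in the regular sequence [xs], then [a / g] is locally in the ring. *)
Lemma regular_fraction I xs g a : is_ideal I -> regular_mod I xs -> xs != [::] ->
  (forall c, sat I (g * c) -> sat I c) ->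
  (forall i, (i < size xs)%N -> exists2 h, lexnz (take i xs ++ drop i.+1 xs) h &
     sat (addI I g) (h * a)) ->
  sat (addI I g) a.
Proof.
elim: xs I g a => // x xs IH I g a II reg _ greg den.
have [h0 /= nz0 sat0] := den 0%N isT.
rewrite drop0 in nz0.
case: xs => [|x1 xs1] in IH reg den nz0 *.
  have [z zh] := nz0; rewrite -[a]mul1r -zh -mulrA.
  by apply: idealM => //; apply/sat_ideal/addI_ideal.
set xs := x1 :: xs1 in IH reg den nz0.
have [s sm [b Ib _]] := sat0.
have [xm xreg _] := reg.
have xsreg : regular_mod (addI I x) xs by case: reg.
have SI := sat_ideal II.
have h0reg c : sat I (h0 * c) -> sat I c.
  by apply: (regular_lexnz II reg); apply: lexnz_cons.
have h0regx c : sat (addI I x) (h0 * c) -> sat (addI I x) c.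
  exact: (regular_lexnz (addI_ideal x II) xsreg nz0).
have Ig := addI_ideal h0 II.
have SIg := sat_ideal Ig.
suff [t tm [c Ic _]] : sat (addI I h0) b.
  have : sat I (h0 * (t * s * a - g * c)).
    apply: sat_in.
    have -> : h0 * (t * s * a - g * c) = t * (s * (h0 * a) - g * b) + g * (t * b - h0 * c) by ring.
    by apply: II.2 => //; apply: idealM.
  move=> /h0reg[u um Iu]; exists (u * t * s); first by rewrite !primeM // !negb_or um tm.
  exists (u * c) => //.
  by have -> : u * t * s * a - g * (u * c) = u * (t * s * a - g * c) by ring.
pose den_ok h := sat (addI I g) (h * a).
have okb h : den_ok h -> sat (addI I h0) (h * b).
  move=> [t tm [c Ic _]].
  have : sat I (g * (t * h * b - s * h0 * c)).
    apply: sat_in.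
    have -> : g * (t * h * b - s * h0 * c) =
      (- (t * h)) * (s * (h0 * a) - g * b) + (s * h0) * (t * (h * a) - g * c) by ring.
    by apply: II.2 => //; apply: idealM.
  move=> /greg[u um Iu]; exists (u * t); first by rewrite primeM // negb_or um.
  exists (u * s * c) => //.
  by have -> : u * t * (h * b) - h0 * (u * s * c) = u * (t * h * b - s * h0 * c) by ring.
have cancel_x y : sat (addI I h0) (x * y) -> sat (addI I h0) y.
  move=> [t tm [c Ic _]].
  have /h0regx[u um [d Id _]] : sat (addI I x) (h0 * c).
    apply: sat_in; exists (t * y) => //.
    have -> : h0 * c - x * (t * y) = - (t * (x * y) - h0 * c) by ring.
    exact: idealN.
  have /xreg[v vm Iv] : sat I (x * (u * t * y - h0 * d)).
    apply: sat_in.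
    have -> : x * (u * t * y - h0 * d) = u * (t * (x * y) - h0 * c) + h0 * (u * c - x * d) by ring.
    by apply: II.2 => //; apply: idealM.
  exists (v * u * t); first by rewrite !primeM // !negb_or vm um.
  exists (v * d) => //.
  by have -> : v * u * t * y - h0 * (v * d) = v * (u * t * y - h0 * d) by ring.
apply/sat_sat/(@nakayama (sat (addI I h0))
   (fun z => forall h, den_ok h -> sat (addI I h0) (h * z)) x) => //.
  split=> [h _|c u v Hu Hv h hok]; first by rewrite mulr0; apply: ideal0.
  by rewrite mulrDr mulrCA; apply: SIg.2; [apply: Hu|apply: Hv].
move=> z Hz.
have [t tm [c [d Id _] _]] : sat (addI (addI I x) h0) z.
  apply: (IH _ _ _ (addI_ideal x II)) => // i iS.
  have [h [k [y0 [w [nzy hE]]]] hok] := den i.+1 iS.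
  exists y0 => //.
  have : sat (addI I h0) ((y0 + x * w) * z).
    have xk j y : sat (addI I h0) (x ^+ j * y) -> sat (addI I h0) y.
      elim: j => [|j IHj]; first by rewrite expr0 mul1r.
      by rewrite exprS -mulrA => /cancel_x.
    by apply: (xk k); rewrite mulrA -hE; apply: Hz.
  move=> [t tm [c Ic _]]; exists t => //; exists c => //; exists (- (t * w * z)) => //.
  by have -> : t * (y0 * z) - h0 * c - x * - (t * w * z) =
    t * ((y0 + x * w) * z) - h0 * c by ring.
exists t, d; split=> //; last first.
  apply: sat_in; exists c => //.
  by have -> : t * z - x * d - h0 * c = t * z - h0 * c - x * d by ring.
move=> h hok; apply: cancel_x.
have -> : x * (h * d) = t * (h * z) + (- h) * (t * z - x * d) by ring.
apply: SIg.2; first exact: Hz.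
apply: idealM => //; apply: sat_in; exists c => //.
by have -> : t * z - x * d - h0 * c = t * z - h0 * c - x * d by ring.
Qed.

Lemma regular_sequence_mod xs : regular_sequence xs -> {subset xs <= m} ->
  regular_mod (fun x => x = 0) xs.
Proof.
move=> [reg _].
suff H l xs1 I : xs = l ++ xs1 -> (forall x, I x <-> lspan l x) ->
    {subset xs1 <= m} -> regular_mod I xs1 by apply: (H [::]).
elim: xs1 l I => //= x xs1 IH l I xsE IE sub.
have xm : x \in m by apply: sub; rewrite mem_head.
have tl : take (size l) xs = l by rewrite xsE take_size_cat.
split=> //.
  move=> a [s sm]; rewrite IE => Isxa; exists s => //; apply/IE.
  have := reg (size l); rewrite tl xsE size_cat nth_cat ltnn subnn /= addnS ltnS leq_addr.
  move=> /(_ isT (s * a)) H; apply/ideal_spanP/H; apply/ideal_spanP.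
  by rewrite mulrCA.
apply: (IH (rcons l x)).
- by rewrite cat_rcons.
- move=> z; split.
    move=> [a /IE lz _]; rewrite -[z](subrK (x * a)).
    have lI := lspan_is_ideal (rcons l x).
    apply: idealD => //.
      by apply: lspan_sub lz => y yl; rewrite mem_rcons inE yl orbT.
    by rewrite mulrC; apply: idealM => //; apply: mem_lspan; rewrite mem_rcons mem_head.
  have lI := lspan_is_ideal l.
  apply: (@lspan_ideal _ (addI I x)).
    have [I0 ID] := addI_ideal x lI; split; first by exists 0 => //; apply/IE; case: I0 => a; rewrite mulr0 subr0 => *; apply: ideal0.
    move=> a u v [b /IE Ib _] [c /IE Ic _]; have [||d Id _] := ID a u v; [by exists b|by exists c|].
    by exists d => //; apply/IE.
  move=> y; rewrite mem_rcons inE => /orP[/eqP->|yl].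
    by exists 1 => //; apply/IE; rewrite mulr1 subrr; apply: ideal0.
  by exists 0 => //; apply/IE; rewrite mulr0 subr0; apply: mem_lspan.
- by move=> y yxs; apply: sub; rewrite inE yxs orbT.
Qed.
End Local.
End LexNonzero.

Definition generated (B A : comNzRingType) (phi : B -> A) (l : seq A) : Prop :=
  forall T : A -> Prop, (forall b, T (phi b)) -> (forall a, a \in l -> T a) ->
  (forall u v, T u -> T v -> T (u + v)) -> (forall u v, T u -> T v -> T (u * v)) ->
  forall a, T a.

Section Generation.
Variables (B A : comNzRingType).

Definition adjoin (phi : {rmorphism B -> A}) (a : A) : {rmorphism {poly B} -> A} :=
  horner_morph (fun b => mulrC a (phi b)).

Lemma adjoinE phi a p : adjoin phi a p = (map_poly phi p).[a].
Proof. by []. Qed.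

Lemma generated_adjoin (phi : {rmorphism B -> A}) a l :
  generated phi (a :: l) -> generated (adjoin phi a) l.
Proof.
move=> H T Tphi Tl TD TM; apply: H => // [b|x].
  by have := Tphi b%:P; rewrite adjoinE map_polyC hornerC.
rewrite inE => /orP[/eqP->|]; last exact: Tl.
by have := Tphi 'X; rewrite adjoinE map_polyX hornerX.
Qed.

Lemma generated_nil (phi : {rmorphism B -> A}) :
  generated phi [::] -> forall a, exists b, phi b = a.
Proof.
apply=> // [b|u v [b <-] [c <-]|u v [b <-] [c <-]]; first by exists b.
  by exists (b + c); rewrite rmorphD.
by exists (b * c); rewrite rmorphM.
Qed.

Lemma noeth_image (phi : {rmorphism B -> A}) :
  (forall a, exists b, phi b = a) -> noeth B -> noeth A.
Proof.
move=> sur NB f; have [g gP] := choice (fun n => sur (f n)).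
have [N HN] := NB g; exists N; rewrite -gP.
have -> : mkseq f N = map phi (mkseq g N).
  by rewrite /mkseq -map_comp; apply: eq_map => n /=; rewrite gP.
elim: (mkseq g N) (g N) HN => [|b l IH] x /=; first by move=> ->; rewrite rmorph0.
by move=> [c [y [/IH ly ->]]]; exists (phi c), (phi y); rewrite rmorphD rmorphM.
Qed.
End Generation.

Lemma noeth_field (K : fieldType) : noeth K.
Proof.
move=> f; have [f0|f0] := eqVneq (f 0%N) 0; first by exists 0%N.
by exists 1%N, (f 1%N / f 0%N), 0; split=> //; rewrite divfK // addr0.
Qed.

Lemma noeth_poly (B : comNzRingType) : noeth B -> noeth {poly B}.
Proof.
move=> NB f; apply: contrapT => noN.
have nspan N : ~ lspan (mkseq f N) (f N) by move=> H; apply: noN; exists N.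
pose I p := exists N, lspan (mkseq f N) p.
have mono N M p : (N <= M)%N -> lspan (mkseq f N) p -> lspan (mkseq f M) p.
  move=> NM; apply: lspan_sub => _ /mapP[n + ->]; rewrite mem_iota => /andP[_ nN].
  by apply: map_f; rewrite mem_iota /= (leq_trans nN).
have II : is_ideal I.
  split; first by exists 0%N.
  move=> a u v [N HN] [M HM]; exists (maxn N M).
  by apply: (lspan_is_ideal _).2; [apply: mono HN; apply: leq_maxl|apply: mono HM; apply: leq_maxr].
have ex l : exists p, (forall x, x \in l -> I x) -> [/\ I p, ~ lspan l p &
    forall q, I q -> ~ lspan l q -> (size p <= size q)%N].
  have [lI|nlI] := pselect (forall x, x \in l -> I x); last by exists 0.
  have [M HM] : exists M, forall x, x \in l -> lspan (mkseq f M) x.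
    elim: l lI => [|a l IH] lI; first by exists 0%N.
    have [M HM] := IH (fun x xl => lI x (mem_behead (s := a :: l) xl)).
    have [N HN] := lI a (mem_head _ _); exists (maxn N M) => x.
    rewrite inE => /orP[/eqP->|/HM]; last by apply: mono; apply: leq_maxr.
    by apply: mono HN; apply: leq_maxl.
  pose T n := `[< exists p, [/\ I p, ~ lspan l p & size p = n] >].
  have exT : exists n, T n.
    exists (size (f M)); apply/asboolP; exists (f M); split=> //.
      by exists M.+1; apply: mem_lspan; rewrite mkseqS mem_rcons mem_head.
    by move=> lf; apply: (nspan M); apply: lspan_ideal lf => //; apply: lspan_is_ideal.
  case: (ex_minnP exT) => n /asboolP[p [Ip nlp <-]] minp.
  exists p => _; split=> // q Iq nlq; apply: minp; apply/asboolP; exists q; by split.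
have [next nextP] := choice ex.
have [g gE] := seq_rec next.
have gI n : forall x, x \in mkseq g n -> I x.
  elim: n => // n IH x; rewrite mkseqS mem_rcons inE => /orP[/eqP->|]; last exact: IH.
  by rewrite gE; case: (nextP _ IH).
have gP n : [/\ I (g n), ~ lspan (mkseq g n) (g n) &
    forall q, I q -> ~ lspan (mkseq g n) q -> (size (g n) <= size q)%N].
  by rewrite gE; apply: nextP; apply: gI.
have [N /lspanP[c cE]] := NB (fun n => lead_coef (g n)).
have [IgN ngN mingN] := gP N.
rewrite size_mkseq in cE.
have size_g i : (i < N)%N -> (size (g i) <= size (g N))%N.
  move=> iN; have [_ _ ming] := gP i; apply: ming => // li; apply: ngN.
  apply: lspan_sub li => _ /mapP[n + ->]; rewrite mem_iota => /andP[_ ni].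
  by apply: map_f; rewrite mem_iota /= (ltn_trans ni).
pose r := \sum_(i < N) (c i *: 'X^(size (g N) - size (g i))) * g i.
have lr : lspan (mkseq g N) r.
  apply/lspanP; exists (fun i => c i *: 'X^(size (g N) - size (g i))).
  by rewrite size_mkseq; apply: eq_bigr => i _; rewrite nth_mkseq.
have lid := lspan_is_ideal (mkseq g N).
suff : (size (g N - r)%R < size (g N))%N.
  rewrite ltnNge mingN //.
    by apply: idealB => //; apply: lspan_ideal lr => // x; apply: gI.
  by move=> l; apply: ngN; rewrite -(subrK r (g N)); apply: idealD.
have gN0 : g N != 0 by apply/eqP=> g0; apply: ngN; rewrite g0; apply: ideal0.
have sN : (0 < size (g N))%N by rewrite size_poly_gt0.
rewrite -(prednK sN) ltnS; apply/leq_sizeP => j.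
rewrite coefB /r coef_sum leq_eqVlt => /orP[/eqP<-|ltj].
  rewrite -[(g N)`__]/(lead_coef (g N)) cE -sumrB big1 // => i _.
  rewrite nth_mkseq // -scalerAl coefZ coefXnM.
  have [_ nl _] := gP i.
  have gi0 : g i != 0 by apply/eqP=> g0; apply: nl; rewrite g0; apply: ideal0; apply: lspan_is_ideal.
  have si : (0 < size (g i))%N by rewrite size_poly_gt0.
  have := size_g i (ltn_ord i); move=> le_i.
  rewrite ifF; last by apply/negbTE; rewrite -leqNgt; lia.
  have -> : ((size (g N)).-1 - (size (g N) - size (g i)) = (size (g i)).-1)%N by lia.
  by rewrite -lead_coefE subrr.
rewrite prednK // in ltj.
rewrite nth_default // sub0r big1 ?oppr0 // => i _.
rewrite -scalerAl coefZ coefXnM; case: ifP => _; first by rewrite mulr0.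
rewrite nth_default ?mulr0 //.
move: (size_g i (ltn_ord i)) ltj; move: (size (g i)) (size (g N)) => p q; lia.
Qed.

Lemma noeth_generated (B A : comNzRingType) (phi : {rmorphism B -> A}) l :
  noeth B -> generated phi l -> noeth A.
Proof.
elim: l B phi => [|a l IH] B phi NB gen.
  exact: noeth_image (generated_nil gen) NB.
exact: IH (noeth_poly NB) (generated_adjoin gen).
Qed.

Section Zariski.
Variable L : fieldType.

(* The localization of the image of [phi] at some element is a field. *)
Definition goldman (B : comNzRingType) (phi : B -> L) : Prop :=
  exists b, phi b != 0 /\
    forall x, phi x != 0 -> exists y k, phi (x * y) = phi b ^+ k.

Lemma goldman_algebraic (B : comNzRingType) (phi : {rmorphism B -> L}) a :
  goldman (adjoin phi a) ->
  exists p : {poly B}, map_poly phi p != 0 /\ (map_poly phi p).[a] = 0.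
Proof.
move=> [b [b0 Hb]]; apply: contrapT => noalg.
have inj p : (map_poly phi p).[a] = 0 -> map_poly phi p = 0.
  by move=> pa; apply: contrapT => /eqP np; apply: noalg; exists p.
pose mb := map_poly phi b.
have mb0 : mb != 0.
  by apply: contraNneq b0 => mb0; rewrite adjoinE -/mb mb0 horner0.
pose x := 1 + 'X * b; pose mx := 1 + 'X * mb.
have mxE : map_poly phi x = mx by rewrite rmorphD rmorphM rmorph1 /= map_polyX.
have size_mx : (1 < size mx)%N.
  by rewrite /mx addrC mulrC -polyC1 size_MXaddC (negbTE mb0) /= ltnS size_poly_gt0.
have x0 : adjoin phi a x != 0.
  by apply/eqP=> /inj; rewrite mxE => mx0; rewrite mx0 size_poly0 in size_mx.
have [y [k xy]] := Hb x x0.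
have : map_poly phi (x * y - b ^+ k) = 0.
  by apply: inj; rewrite -adjoinE rmorphB rmorphXn /= xy subrr.
rewrite rmorphB rmorphM rmorphXn /= mxE => /eqP; rewrite subr_eq0 => /eqP mxy.
have cop : coprimep mx (mb ^+ k).
  apply/coprimep_expr/Bezout_coprimepP; exists (1, - 'X) => /=.
  by rewrite mul1r mulNr /mx addrK eqpxx.
have dv : mx %| mb ^+ k by rewrite -mxy dvdp_mulIl.
have := dvdp_gcd_idl dv => /eqp_size; move: cop; rewrite /coprimep => /eqP->.
by move=> sz; rewrite -sz in size_mx.
Qed.

Section Step.
Variables (B : comNzRingType) (phi : {rmorphism B -> L}).
Local Notation int := (integralOver phi).

Let almost_int d u := exists s, int (phi d ^+ s * u).

Let intX u n : int u -> int (u ^+ n).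
Proof.
by move=> iu; elim: n => [|n IH]; [apply: integral1|rewrite exprS; apply: integral_mul].
Qed.

Let almost_intD d u v : almost_int d u -> almost_int d v -> almost_int d (u + v).
Proof.
move=> [s iu] [t iv]; exists (s + t)%N; rewrite mulrDr exprD.
have id := intX _ (integral_id phi d).
apply: integral_add; last by rewrite -mulrA; apply: integral_mul.
by rewrite [_ ^+ s * _]mulrC -mulrA; apply: integral_mul.
Qed.

Let almost_intM d u v : almost_int d u -> almost_int d v -> almost_int d (u * v).
Proof.
move=> [s iu] [t iv]; exists (s + t)%N; rewrite exprD mulrACA; exact: integral_mul.
Qed.

Let almost_int_id d b : almost_int d (phi b).
Proof. by exists 0%N; rewrite expr0 mul1r; apply: integral_id. Qed.

Let almost_intX d u n : almost_int d u -> almost_int d (u ^+ n).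
Proof.
move=> iu; elim: n => [|n IH]; last by rewrite exprS; apply: almost_intM.
by rewrite expr0 -(rmorph1 phi); apply: almost_int_id.
Qed.

Let almost_int_mul d e u : almost_int d u -> almost_int (d * e) u.
Proof.
move=> [s iu]; exists s; rewrite rmorphM exprMn mulrAC mulrC.
by apply: integral_mul => //; apply/intX/integral_id.
Qed.

Let almost_int_root p a : map_poly phi p != 0 -> (map_poly phi p).[a] = 0 ->
  exists2 c, phi c != 0 & almost_int c a.
Proof.
set mp := map_poly phi p => mp0 pa; pose n := (size mp).-1; pose c := p`_n.
have cn : phi c != 0.
  by have := mp0; rewrite -lead_coef_eq0 /lead_coef -/n coef_map.
have n0 : (0 < n)%N.
  rewrite lt0n; apply: contraNneq cn => n0.
  have smp : (size mp <= 1)%N by rewrite -[size mp]prednK ?size_poly_gt0 // -/n n0.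
  by move: pa; rewrite (size1_polyC smp) hornerC /c n0 -coef_map => ->.
exists c => //; exists 1%N; rewrite expr1.
pose q := 'X^n + \poly_(i < n) (p`_i * c ^+ (n.-1 - i)).
have sq : (size (\poly_(i < n) (p`_i * c ^+ (n.-1 - i)))%R < size ('X^n : {poly B}))%N.
  by rewrite size_polyXn ltnS size_poly.
exists q; first by rewrite monicE lead_coefDl // lead_coefXn.
rewrite /root rmorphD /= map_polyXn hornerD hornerXn.
rewrite (_ : (map_poly phi _).[_] = \sum_(i < n) phi (p`_i) * phi c ^+ n.-1 * a ^+ i); last first.
  rewrite (@horner_coef_wide _ n); last by rewrite (leq_trans (size_poly _ _)) // size_poly.
  apply: eq_bigr => i _; rewrite coef_map coef_poly ltn_ord /= rmorphM rmorphXn exprMn.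
  rewrite -!mulrA; congr (_ * _); rewrite !mulrA -exprD subnK // -ltnS prednK //.
have pE : \sum_(i < n.+1) phi (p`_i) * a ^+ i = 0.
  apply: etrans pa; rewrite (@horner_coef_wide _ n.+1) //; last by rewrite /n; case: (size mp).
  by apply: eq_bigr => i _; rewrite coef_map.
rewrite exprMn -[in X in X + _](prednK n0) exprS.
have -> : \sum_(i < n) phi (p`_i) * phi c ^+ n.-1 * a ^+ i
    = phi c ^+ n.-1 * \sum_(i < n) phi (p`_i) * a ^+ i.
  by rewrite mulr_sumr; apply: eq_bigr => i _; rewrite mulrCA mulrA.
rewrite (prednK n0) [phi c * _]mulrC -mulrA -mulrDr addrC.
by move: pE; rewrite big_ord_recr /= -/c => ->; rewrite mulr0.
Qed.

Let integral_inv u : int u -> u != 0 -> exists2 c, phi c != 0 & int (phi c * u^-1).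
Proof.
move=> iu u0; have [q0 mq] := iu.
have : map_poly phi q0 != 0 by rewrite monic_neq0 // monic_map.
elim/poly_ind: q0 {mq} => [|q c IH]; first by rewrite rmorph0 eqxx.
rewrite rmorphD rmorphM /= map_polyX map_polyC /= => nz.
rewrite /root hornerMXaddC.
have [c0|c0] := eqVneq (phi c) 0.
  rewrite c0 addr0 mulf_eq0 (negbTE u0) orbF; apply: IH.
  by apply: contraNneq nz => ->; rewrite c0 mul0r polyC0 addr0.
rewrite addrC addr_eq0 => /eqP cE; exists c => //.
rewrite cE mulNr mulfK //; apply: integral_opp; apply: integral_horner iu.
by apply/integral_poly => i; rewrite coef_map; apply: integral_id.
Qed.

Lemma goldman_adjoin a : goldman (adjoin phi a) -> goldman phi.
Proof.
move=> G; have [p [p0 pa]] := goldman_algebraic G; have [b [b0 Hb]] := G.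
have [c c0 ca] := almost_int_root p0 pa.
have all q : almost_int c (adjoin phi a q).
  rewrite adjoinE horner_coef.
  elim/big_ind: _ => [||i _]; first by rewrite -(rmorph0 phi); apply: almost_int_id.
    exact: almost_intD.
  by apply: almost_intM; [rewrite coef_map; apply: almost_int_id|apply: almost_intX].
have [s ib] := all b.
have cb0 : phi c ^+ s * adjoin phi a b != 0 by rewrite mulf_neq0 ?expf_neq0.
have [e e0 ie] := integral_inv ib cb0.
have ibV : almost_int (c * e) (adjoin phi a b)^-1.
  exists 1%N; rewrite expr1 rmorphM.
  have -> : phi c * phi e * (adjoin phi a b)^-1 =
     phi c ^+ s.+1 * (phi e * (phi c ^+ s * adjoin phi a b)^-1).
    have g0 : phi c ^+ s != 0 by rewrite expf_neq0.
    rewrite exprS; move: (phi c ^+ s) (adjoin phi a b) b0 g0 => g d d0 g0.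
    by field; rewrite d0 g0.
  by apply: integral_mul => //; apply/intX/integral_id.
exists (c * e); split; first by rewrite rmorphM mulf_neq0.
move=> x x0; set d := c * e in ibV *.
have d0 : phi d != 0 by rewrite rmorphM mulf_neq0.
have [y [k xy]] : exists y k, adjoin phi a (x%:P * y) = adjoin phi a b ^+ k.
  by apply: Hb; rewrite adjoinE map_polyC hornerC.
have [M [q mq /rootP qv]] : almost_int d (phi x)^-1.
  have -> : (phi x)^-1 = adjoin phi a y * (adjoin phi a b)^-1 ^+ k.
    rewrite exprVn -xy rmorphM [adjoin _ _ x%:P]adjoinE map_polyC hornerC.
    rewrite invfM mulrCA mulfV ?mulr1 //.
    apply: contraNneq b0 => y0; have := xy; rewrite rmorphM y0 mulr0.
    by move/esym/eqP; rewrite expf_eq0 => /andP[].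
  by apply: almost_intM; [apply: almost_int_mul|apply: almost_intX].
clearbody d; set v := phi d ^+ M / phi x in qv.
pose m := (size q).-1.
have mapq_size : size (map_poly phi q) = m.+1.
  rewrite size_map_poly_id0; last by rewrite (monicP mq) rmorph1 oner_neq0.
  by rewrite prednK // size_poly_gt0 monic_neq0.
exists (- \sum_(i < m) q`_i * d ^+ (M * i) * x ^+ (m - i.+1)), (M * m)%N.
have vx : v * phi x = phi d ^+ M by rewrite divfK.
have vxn i : (i <= m)%N -> v ^+ i * phi x ^+ m = phi d ^+ (M * i) * phi x ^+ (m - i).
  by move=> im; rewrite -{1}(subnKC im) exprD mulrA -exprMn vx exprM.
have := congr1 (fun z => z * phi x ^+ m) qv; rewrite mul0r horner_coef mapq_size.
have lq : (map_poly phi q)`_m = 1.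
  by rewrite coef_map /= -[q`_m]/(lead_coef q) (monicP mq) rmorph1.
rewrite big_ord_recr /= lq mul1r.
rewrite mulrDl vxn // subnn expr0 mulr1 addrC => /eqP; rewrite addr_eq0 => /eqP ->.
rewrite rmorphM rmorphN mulrN; congr (- _).
rewrite rmorph_sum mulr_sumr mulr_suml; apply: eq_bigr => i _.
rewrite coef_map /= -[RHS]mulrA vxn ?(ltnW (ltn_ord i)) // !rmorphM !rmorphXn.
by rewrite -(subnSK (ltn_ord i)) exprS; ring.
Qed.
End Step.

Lemma goldman_generated l (B : comNzRingType) (phi : {rmorphism B -> L}) :
  generated phi l -> goldman phi.
Proof.
elim: l B phi => [|a l IH] B phi gen; last exact: goldman_adjoin (IH _ _ (generated_adjoin gen)).
exists 1; rewrite rmorph1 oner_neq0; split=> // x x0.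
have [y yE] := generated_nil gen (phi x)^-1.
by exists y, 0%N; rewrite rmorphM yE mulfV // expr1n.
Qed.

Lemma zariski (K : fieldType) (kappa : {rmorphism K -> L}) l t :
  generated kappa l -> exists2 p : {poly K}, p != 0 & (map_poly kappa p).[t] = 0.
Proof.
move=> gen; have [|p [p0 pt]] := @goldman_algebraic _ kappa t; last first.
  by exists p => //; rewrite map_poly_eq0 in p0.
apply: (@goldman_generated l) => T Tk; apply: gen => k.
by have := Tk k%:P; rewrite adjoinE map_polyC hornerC.
Qed.
End Zariski.

(** * Edge rings *)

Section EdgeRing.
Variables (K : fieldType) (V : finType) (e : rel V).
Local Notation S := {mpoly K[#|V|]}.
Local Notation A := (edge_ring K e).

Definition epi : {rmorphism S -> A} := \pi_({ideal_quot (edge_idealr K e)})%qT.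

Lemma epi_surj (a : A) : exists p, epi p = a.
Proof. by exists (repr a); rewrite /epi /= reprK. Qed.

Lemma epi_eq p q : (epi p == epi q) = (p - q \in @edge_ideal K V e).
Proof. by rewrite Quotient.idealrBE. Qed.

Definition kc : {rmorphism K -> A} := epi \o (@mpolyC #|V| K).
Definition xv v : A := epi 'X_(enum_rank v).

Lemma xv_edge u v : e u v -> xv u * xv v = 0.
Proof.
move=> euv; apply/eqP; rewrite -rmorphM -(rmorph0 epi) epi_eq subr0.
apply/ideal_spanP/mem_lspan/mapP; exists (u, v) => //.
by rewrite mem_enum.
Qed.

Lemma edge_lift (B : comNzRingType) (kappa : {rmorphism K -> B}) (h : V -> B) :
  (forall u v, e u v -> h u * h v = 0) ->
  exists phi : {rmorphism A -> B},
    (forall k, phi (kc k) = kappa k) /\ (forall v, phi (xv v) = h v).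
Proof.
move=> he; pose F : {rmorphism S -> B} := mmap kappa (h \o enum_val).
have F0 p : p \in @edge_ideal K V e -> F p = 0.
  move=> /asboolP[c ->]; rewrite rmorph_sum big1 // => i _; rewrite rmorphM /=.
  have /mapP[[u v]] := mem_nth 0 (ltn_ord i).
  rewrite mem_enum /= => euv ->.
  by rewrite rmorphM /= !mmapX !mmap1U /= !enum_rankK he // mulr0.
pose f (a : A) := F (repr a).
have fE p : f (epi p) = F p.
  apply/eqP; rewrite -subr_eq0 -rmorphB F0 //.
  by rewrite -epi_eq; apply/eqP; rewrite /epi /= reprK.
have fB : zmod_morphism f.
  move=> a b; have [p <-] := epi_surj a; have [q <-] := epi_surj b.
  by rewrite -rmorphB !fE rmorphB.
have fM : monoid_morphism f.
  split; first by rewrite -(rmorph1 epi) fE rmorph1.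
  move=> a b; have [p <-] := epi_surj a; have [q <-] := epi_surj b.
  by rewrite -rmorphM !fE rmorphM.
pose hB := GRing.isZmodMorphism.Build A B f fB.
pose hM := GRing.isMonoidMorphism.Build A B f fM.
pose phi : {rmorphism A -> B} := HB.pack f hB hM.
exists phi; split=> [k|v]; rewrite [LHS]fE; first by rewrite /F /= mmapC.
by rewrite /F /= mmapX mmap1U /= enum_rankK.
Qed.

Lemma edge_mono_ind (T : A -> Prop) :
  (forall m : V -> nat, T (\prod_v xv v ^+ m v)) ->
  (forall k a, T a -> T (kc k * a)) ->
  (forall a b, T a -> T b -> T (a + b)) -> forall a, T a.
Proof.
move=> Tm Tk TD a; have [p <-] := epi_surj a.
have TX m : T (epi 'X_[m]).
  have -> : epi 'X_[m] = \prod_v xv v ^+ m (enum_rank v); last exact: Tm.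
  rewrite mpolyXE_id rmorph_prod (reindex enum_rank) /=; last exact/onW_bij/enum_rank_bij.
  by apply: eq_bigr => v _; rewrite rmorphXn.
have TC k m : T (epi (k *: 'X_[m])).
  rewrite -mul_mpolyC rmorphM; exact: Tk.
elim/mpolyind: p => [|c m p _ _ IH]; first by rewrite -(scale0r 'X_[0]).
by rewrite rmorphD; apply: TD.
Qed.

Lemma edge_generated : generated (kc : K -> A) [seq xv v | v : V].
Proof.
move=> T Tk Tx TD TM.
have T1 : T 1 by rewrite -(rmorph1 kc).
have TX a n : T a -> T (a ^+ n).
  by move=> Ta; elim: n => [|n IH]; [rewrite expr0|rewrite exprS; apply: TM].
apply: edge_mono_ind => [m|k a Ta|a b]; [|exact: TM|exact: TD].
apply: (big_ind T) => // v _; apply: TX; apply: Tx.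
by apply: map_f; rewrite mem_enum.
Qed.

Lemma edge_morph_eq (B : comNzRingType) (f g : {rmorphism A -> B}) :
  (forall k, f (kc k) = g (kc k)) -> (forall v, f (xv v) = g (xv v)) -> f =1 g.
Proof.
move=> fk fx; apply: edge_generated => // [_ /mapP[v _ ->] //|u v fu fv|u v fu fv].
  by rewrite !rmorphD fu fv.
by rewrite !rmorphM fu fv.
Qed.

Lemma edge_noeth : noeth A.
Proof. exact: (@noeth_generated K A kc _ (@noeth_field K) edge_generated). Qed.

Definition is_restriction (W : {set V}) (tau : A -> A) : Prop :=
  (forall k, tau (kc k) = kc k) /\ (forall v, tau (xv v) = if v \in W then xv v else 0).

Lemma restriction_exists W : exists tau : {rmorphism A -> A}, is_restriction W tau.
Proof.
apply: (@edge_lift A kc (fun v => if v \in W then xv v else 0)) => u v euv.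
by case: ifP; case: ifP; rewrite ?mulr0 ?mul0r // xv_edge.
Qed.

Lemma restriction_ker W (tau : {rmorphism A -> A}) : is_restriction W tau ->
  forall a, lspan [seq xv v | v in ~: W] (a - tau a).
Proof.
move=> [tk tx]; have LI := lspan_is_ideal [seq xv v | v in ~: W].
apply: edge_generated => [k|_ /mapP[v _ ->]|a b Ta Tb|a b Ta Tb].
- by rewrite tk subrr; apply: ideal0.
- rewrite tx; case: ifP => vW; first by rewrite subrr; apply: ideal0.
  by rewrite subr0; apply/mem_lspan/map_f; rewrite mem_enum inE vW.
- by rewrite rmorphD opprD addrACA; apply: idealD.
- rewrite rmorphM.
  have -> : a * b - tau a * tau b = b * (a - tau a) + tau a * (b - tau b) by ring.
  by apply: LI.2 => //; apply: idealM.
Qed.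

Definition is_face_eval (G : {set V}) (rho : A -> S) : Prop :=
  (forall k, rho (kc k) = k%:MP) /\
  (forall v, rho (xv v) = if v \in G then 'X_(enum_rank v) else 0).

Lemma face_eval_exists G : independent e G ->
  exists rho : {rmorphism A -> S}, is_face_eval G rho.
Proof.
move=> /forall_inP IG.
apply: (@edge_lift S (@mpolyC #|V| K)) => u v euv.
case: ifP => uG; last by rewrite mul0r.
case: ifP => vG; last by rewrite mulr0.
by have /forall_inP/(_ _ vG) := IG _ uG; rewrite euv.
Qed.

Lemma face_eval_ker G (rho : {rmorphism A -> S}) : is_face_eval G rho ->
  forall a, rho a = 0 -> lspan [seq xv v | v in ~: G] a.
Proof.
move=> [rk rx] a ra; have [tau tP] := restriction_exists G.
rewrite -[a]subr0 (_ : 0 = tau a); first exact: restriction_ker.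
have <- : (epi \o rho) a = tau a; last by rewrite /= ra rmorph0.
case: tP => tk tx; apply: edge_morph_eq => [k|v] /=; first by rewrite rk tk.
by rewrite rx tx; case: ifP => _; rewrite ?rmorph0.
Qed.
End EdgeRing.

Section AlgebraicDependence.
Variables (K : fieldType) (V : finType) (e : rel V).
Local Notation S := {mpoly K[#|V|]}.
Local Notation A := (edge_ring K e).

Fixpoint box (M r : nat) : seq (seq nat) :=
  if r is r'.+1 then [seq k :: l | k <- iota 0 M, l <- box M r'] else [:: [::]].

Lemma size_box M r : size (box M r) = (M ^ r)%N.
Proof. by elim: r => //= r IH; rewrite size_allpairs size_iota IH expnS. Qed.

Lemma box_uniq M r : uniq (box M r).
Proof.
elim: r => //= r IH; apply: allpairs_uniq => //; first exact: iota_uniq.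
by move=> [k l] [k' l'] _ _ /= [-> ->].
Qed.

Fixpoint mono (B : comNzRingType) (fs : seq B) (l : seq nat) : B :=
  if fs is f :: fs' then f ^+ head 0%N l * mono fs' (behead l) else 1.

Lemma rmorph_mono (B C : comNzRingType) (phi : {rmorphism B -> C}) fs l :
  phi (mono fs l) = mono [seq phi f | f <- fs] l.
Proof.
by elim: fs l => [|f fs IH] l /=; rewrite ?rmorph1 // rmorphM rmorphXn IH.
Qed.

Lemma box_lexnz M (fs : seq A) (c : seq nat -> K) :
  (exists2 l, l \in box M (size fs) & c l != 0) ->
  lexnz fs (\sum_(l <- box M (size fs)) kc K e (c l) * mono fs l).
Proof.
elim: fs c => [|f fs IH] c /=.
  move=> [l]; rewrite inE => /eqP-> c0; rewrite big_seq1 mulr1.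
  by exists (kc K e (c [::])^-1); rewrite -rmorphM mulVf ?rmorph1.
rewrite big_allpairs_dep /= => -[_ /allpairsP[[k0 l0] /= [k0M l0P ->]] c0].
pose s k := \sum_(l <- box M (size fs)) kc K e (c (k :: l)) * mono fs l.
pose nz k := has (fun l => c (k :: l) != 0) (box M (size fs)).
have snz k : nz k -> lexnz fs (s k).
  by move=> /hasP[l lP cl]; apply: IH; exists l.
have sz k : ~~ nz k -> s k = 0.
  move=> /hasPn H; rewrite /s big_seq big1 // => l /H; rewrite negbK => /eqP->.
  by rewrite rmorph0 mul0r.
have exk : exists k, nz k by exists k0; apply/hasP; exists l0.
have [k nzk mink] := ex_minnP exk.
have kM : (k < M)%N.
  have k0M' : (k0 < M)%N by move: k0M; rewrite mem_iota.
  by apply: leq_ltn_trans k0M'; apply: mink; apply/hasP; exists l0.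
exists k, (s k), (\sum_(k.+1 <= j < M) f ^+ (j - k.+1) * s j); split; first exact: snz.
have -> : \sum_(x <- iota 0 M) \sum_(l <- box M (size fs))
    kc K e (c (x :: l)) * (f ^+ x * mono fs l) = \sum_(0 <= x < M) f ^+ x * s x.
  rewrite /index_iota subn0; apply: eq_bigr => x _; rewrite mulr_sumr.
  by apply: eq_bigr => l _; rewrite mulrCA.
rewrite (@big_cat_nat _ _ _ k) //=; last exact: ltnW.
rewrite big_nat big1 ?add0r => [|j /andP[_ jk]]; last first.
  rewrite sz ?mulr0 //; apply: contraTN jk => /mink; by rewrite -leqNgt.
rewrite big_ltn // mulrDr; congr (_ + _).
rewrite mulrA -exprSr mulr_sumr; apply: eq_big_nat => j /andP[kj _].
by rewrite mulrA -exprD subnKC.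
Qed.

Definition supported (G : {set V}) (E : nat) (p : S) : Prop :=
  forall m, p@_m != 0 -> forall v, (m (enum_rank v) <= if v \in G then E else 0)%N.

Lemma supportedD G E1 E2 p q : supported G E1 p -> supported G E2 q ->
  supported G (maxn E1 E2) (p + q).
Proof.
move=> Hp Hq m; rewrite mcoeffD => nz v.
have [p0|p0] := eqVneq p@_m 0; last first.
  by have := Hp m p0 v; case: ifP => // _ h; rewrite leq_max h.
rewrite p0 add0r in nz.
by have := Hq m nz v; case: ifP => // _ h; rewrite leq_max h orbT.
Qed.

Lemma supportedM G E1 E2 p q : supported G E1 p -> supported G E2 q ->
  supported G (E1 + E2) (p * q).
Proof.
move=> Hp Hq m; rewrite mcoeff_eq0 negbK => /msuppM_le/allpairsP[[m1 m2] /= [m1p m2q ->]] v.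
have {}m1p : p@_m1 != 0 by rewrite mcoeff_eq0 negbK.
have {}m2q : q@_m2 != 0 by rewrite mcoeff_eq0 negbK.
rewrite mnmDE; have := Hp _ m1p v; have := Hq _ m2q v.
by case: ifP => _ h2 h1; apply: (leq_add h1 h2).
Qed.

Lemma supportedC G k : supported G 0 k%:MP.
Proof.
move=> m; rewrite mcoeffC; have [-> _ v|_] := eqVneq m 0%MM; last by rewrite mulr0 eqxx.
by rewrite mnm0E.
Qed.

Lemma supportedX G E p n : supported G E p -> supported G (n * E) (p ^+ n).
Proof.
move=> Hp; elim: n => [|n IH]; first by rewrite expr0 -mpolyC1; apply: supportedC.
by rewrite exprS mulSn; apply: supportedM.
Qed.

Lemma supportedS G E E' p : (E <= E')%N -> supported G E p -> supported G E' p.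
Proof.
by move=> le Hp m /Hp H v; apply: leq_trans (H v) _; case: ifP.
Qed.

Lemma face_eval_supported G (rho : {rmorphism A -> S}) : is_face_eval G rho ->
  forall a, exists E, supported G E (rho a).
Proof.
move=> [rk rx]; apply: edge_generated => [k|_ /mapP[v _ ->]|a b [E1 H1] [E2 H2]|a b [E1 H1] [E2 H2]].
- by exists 0%N; rewrite rk; apply: supportedC.
- exists 1%N; rewrite rx; case: ifP => vG m; last by rewrite mcoeff0 eqxx.
  rewrite mcoeffX; have [<- _ w|_] := eqVneq _ m; last by rewrite eqxx.
   rewrite mnm1E (inj_eq enum_rank_inj).
  by case: eqP => [<-|_]; rewrite ?vG //; case: ifP.
- by exists (maxn E1 E2); rewrite rmorphD; apply: supportedD.
- by exists (E1 + E2)%N; rewrite rmorphM; apply: supportedM.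
Qed.

Lemma supported_mono G E M r (ps : seq S) l :
  (forall p, p \in ps -> supported G E p) -> size ps = r -> l \in box M r ->
  supported G (r * (M * E)) (mono ps l).
Proof.
elim: ps r l => [|p ps IH] r l Hp <- /=; first by rewrite -mpolyC1 => _; apply: supportedC.
move=> /allpairsP[[k l'] /= [kM l'P ->]] /=; rewrite mulSn.
apply: supportedM; last by apply: IH => // q qps; apply: Hp; rewrite inE qps orbT.
apply: (@supportedS _ (k * E)); last by apply: supportedX; apply: Hp; rewrite mem_head.
by rewrite leq_mul2r ltnW ?orbT //; move: kM; rewrite mem_iota.
Qed.

Lemma dependent_rows (N D : nat) (X : 'M[K]_(N, D)) : (D < N)%N ->
  exists2 u : 'rV[K]_N, u != 0 & u *m X = 0.
Proof.
move=> DN; have : kermx X != 0.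
  by rewrite -mxrank_eq0 mxrank_ker -lt0n subn_gt0 (leq_ltn_trans (rank_leq_col X)).
move/rowV0Pn=> [u /sub_kermxP uX u0]; by exists u.
Qed.

(* Dimension count: the monomials of exponents [< M] in [fs] are [M ^ size fs]
   in number, and span a space of dimension [O(M ^ #|G|)]. *)
Lemma face_eval_dependent G (rho : {rmorphism A -> S}) fs : is_face_eval G rho ->
  (#|G| < size fs)%N -> exists2 h, lexnz fs h & rho h = 0.
Proof.
move=> rhoP ltG; set r := size fs in ltG *.
have [E HE] : exists E, forall p, p \in map rho fs -> supported G E p.
  elim: (fs) => [|f fs' [E HE]]; first by exists 0%N.
  have [E' HE'] := face_eval_supported rhoP f.
  exists (maxn E' E) => p; rewrite inE => /orP[/eqP->|/HE].
    by apply: supportedS HE'; apply: leq_maxl.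
  by apply: supportedS; apply: leq_maxr.
pose n := #|G|; pose b := (r * E).+1; pose M := (b ^ n).+1.
pose F := (r * (M * E))%N.
have ltFM : (F.+1 ^ n < M ^ r)%N.
  apply: (@leq_trans (M ^ n.+1)); last by rewrite leq_pexp2l.
  apply: (@leq_ltn_trans ((M * b) ^ n)).
    by apply: leq_exp2r_weak || (case: (n) => // n'; rewrite leq_exp2r // /F /b; nia).
  by rewrite expnMn expnS mulnC ltn_pmul2r // expn_gt0.
pose D := pffun_on (ord0 : 'I_F.+1) (mem G) predT.
have cardD : #|D| = (F.+1 ^ n)%N by rewrite card_pffun_on card_ord.
pose mon (g : {ffun V -> 'I_F.+1}) : 'X_{1..#|V|} := [multinom (g (enum_val i) : nat) | i < #|V|].
pose N := size (box M r).
pose X : 'M[K]_(N, #|D|) := \matrix_(i, j) (rho (mono fs (nth [::] (box M r) i)))@_(mon (enum_val j)).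
have [|u u0 uX] := @dependent_rows N #|D| X; first by rewrite cardD /N size_box.
pose c l := if insub (index l (box M r)) is Some i then u 0 i else 0 : K.
have cE (i : 'I_N) : c (nth [::] (box M r) i) = u 0 i.
  by rewrite /c index_uniq ?box_uniq // valK.
exists (\sum_(l <- box M r) kc K e (c l) * mono fs l).
  apply: box_lexnz; have /rV0Pn[i ui] := u0.
  by exists (nth [::] (box M r) i); rewrite ?mem_nth // cE.
rewrite rmorph_sum; apply/mpolyP => m; rewrite mcoeff0 raddf_sum /=.
have coefE l : (rho (kc K e (c l) * mono fs l))@_m = c l * (rho (mono fs l))@_m.
  by rewrite rmorphM rhoP.1 mcoeffCM.
have [/existsP[g /andP[gD /eqP mE]]|] := boolP [exists g, (g \in D) && (mon g == m)].
  rewrite (big_nth [::]) big_mkord -/N.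
  have := congr1 (fun Y : 'rV_#|D| => Y 0 (enum_rank_in gD g)) uX.
  rewrite !mxE => {2}<-; apply: eq_bigr => i _.
  by rewrite coefE cE !mxE enum_rankK_in // mE.
move=> /existsPn nog; rewrite big_seq big1 // => l lP; rewrite coefE.
have [->|nz] := eqVneq (rho (mono fs l))@_m 0; first by rewrite mulr0.
have Hm : forall v, (m (enum_rank v) <= if v \in G then F else 0)%N.
  apply: (@supported_mono G E M r (map rho fs) l HE _ lP _ _); first by rewrite size_map.
  by rewrite -rmorph_mono.
pose g : {ffun V -> 'I_F.+1} := [ffun v => inord (m (enum_rank v))].
have gE v : g v = m (enum_rank v) :> nat.
  rewrite ffunE inordK // ltnS; apply: leq_trans (Hm v) _; by case: ifP.
case/negP: (nog g); apply/andP; split.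
  apply/pffun_onP; split=> //; apply/subsetP=> v; rewrite inE => gv.
  apply: contraNT gv => vG; apply/eqP/val_inj => /=.
  by rewrite gE; have := Hm v; rewrite (negbTE vG) leqn0 => /eqP.
by apply/eqP/mnmP => i; rewrite mnmE gE enum_valK.
Qed.
End AlgebraicDependence.

(** * Cohen-Macaulayness of disjoint unions of cliques *)

Lemma maximal_quotient (A : comNzRingType) (P : {pred A}) : maximal_ideal P ->
  exists (L : fieldType) (pi : {rmorphism A -> L}),
    (forall x, (pi x == 0) = (x \in P)) /\ (forall y, exists x, pi x = y).
Proof.
move=> [PI max]; pose I : idealr A := HB.pack (P : A -> bool) (isIdealr.Build A P PI).
have [Q [pi [pi0 pi_surj]]] : exists (Q : comNzRingType) (pi : {rmorphism A -> Q}),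
    (forall x, (pi x == 0) = (x \in P)) /\ (forall y, exists x, pi x = y).
  pose pi : {rmorphism A -> {ideal_quot I}} := \pi_({ideal_quot I})%qT.
  exists {ideal_quot I}, pi; split=> [x|y].
    by rewrite -(rmorph0 pi) /pi /= -Quotient.idealrBE subr0.
  by exists (repr y); rewrite /pi /= reprK.
have inv_ex (y : Q) : exists z, (y != 0 -> z * y = 1) /\ (y = 0 -> z = 0).
  have [->|y0] := eqVneq y 0; first by exists 0.
  have [x xy] := pi_surj y.
  have xP : x \notin P by rewrite -pi0 xy.
  have II := idealr_is_ideal PI.
  suff [a [b [aP ab]]] : exists a b, a \in P /\ a + b * x = 1.
    exists (pi b); split=> [_|/eqP]; last by rewrite (negbTE y0).
    rewrite -xy -rmorphM -(rmorph1 pi) -ab rmorphD.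
    by have /eqP-> : pi a == 0; [rewrite pi0|rewrite add0r].
  apply: contrapT => no1; case/negP: xP.
  pose J : {pred A} := fun z => `[< exists a b, a \in P /\ a + b * x = z >].
  apply: (max J); last by apply/asboolP; exists 0, 1; split; [exact: (ideal0 II)|ring].
    split.
    - by apply/asboolP; exists 0, 0; split; [exact: (ideal0 II)|ring].
    - by apply/negP=> /asboolP.
    - move=> k u v /asboolP[a [b [aP <-]]] /asboolP[c [d [cP <-]]].
      apply/asboolP; exists (k * a + c), (k * b + d); split; last by ring.
      by have [_ _ H] := PI; apply: H.
  by move=> z zP; apply/asboolP; exists z, 0; split=> //; ring.
have [inv invP] := choice inv_ex.
pose L : fieldType := HB.pack (GRing.ComNzRing.sort Q) (GRing.ComNzRing_isField.Build Q
  (fun y => (invP y).1) ((invP 0).2 erefl)).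
by exists L, pi.
Qed.

Lemma maximal_prime (A : comNzRingType) (P : {pred A}) : maximal_ideal P -> prime_ideal P.
Proof.
move=> MP; have [L [pi [pi0 _]]] := maximal_quotient MP; split; first by case: MP.
by move=> u v; rewrite -!pi0 rmorphM mulf_eq0.
Qed.

Lemma generated_comp (B A L : comNzRingType) (phi : B -> A) (pi : {rmorphism A -> L}) l :
  (forall y, exists x, pi x = y) -> generated phi l ->
  generated (pi \o phi) (map pi l).
Proof.
move=> sur gen T Tphi Tl TD TM y; have [x <-] := sur y; move: x.
apply: gen => [b|a al|u v Tu Tv|u v Tu Tv]; first exact: Tphi.
- by apply: Tl; apply: map_f.
- by rewrite rmorphD; apply: TD.
- by rewrite rmorphM; apply: TM.
Qed.

Section EdgeRingDimension.
Variables (K : fieldType) (V : finType) (e : rel V).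
Local Notation A := (edge_ring K e).

Lemma maximal_algebraic (P : {pred A}) (t : A) : maximal_ideal P ->
  exists2 p : {poly K}, p != 0 & (map_poly (kc K e) p).[t] \in P.
Proof.
move=> /maximal_quotient[L [pi [pi0 pis]]].
have gen := generated_comp pis (@edge_generated K V e).
have [p p0 pt] := @zariski L K (pi \o kc K e) _ (pi t) gen.
exists p => //; rewrite -pi0 -horner_map -map_poly_comp; exact/eqP.
Qed.

Lemma edge_chain_bound d (P : {pred A}) n Q :
  (forall G : {set V}, independent e G -> (#|G| <= d)%N) ->
  prime_chain_to P n Q -> (n <= d)%N.
Proof.
move=> Gd [Qp Qs _]; have [fs <- fsQ] := prime_chain_lexnz Qp Qs.
have Q0 := Qp 0%N isT.
pose G := [set v | xv K e v \notin Q 0%N].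
have IG : independent e G.
  apply/forall_inP=> u; rewrite inE => uQ; apply/forall_inP=> v; rewrite inE => vQ.
  apply: contraTN isT => /(xv_edge K) uv.
  have : xv K e u * xv K e v \in Q 0%N.
    by rewrite uv; apply: (ideal0 (idealr_is_ideal Q0.1)).
  by rewrite primeM // (negbTE uQ) (negbTE vQ).
rewrite leqNgt; apply/negP=> ltd.
have [rho rhoP] := face_eval_exists K IG.
have [h /fsQ hQ /(face_eval_ker rhoP) hs] :=
  face_eval_dependent rhoP (leq_ltn_trans (Gd G IG) ltd).
case/negP: hQ; apply: (lspan_ideal (idealr_is_ideal Q0.1)) hs => _ /mapP[v + ->].
by rewrite mem_enum !inE negbK.
Qed.
End EdgeRingDimension.

Lemma ideal_coef_mul (A : comNzRingType) (I : A -> Prop) (q Y : {poly A}) u :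
  is_ideal I -> u * lead_coef q = 1 ->
  (forall k, I (q * Y)`_k) -> forall k, I Y`_k.
Proof.
move=> II uq HqY; suff H n k : (size Y <= k + n)%N -> I Y`_k.
  by move=> k; apply: (H (size Y)); apply: leq_addl.
elim: n k => [|n IH] k kn; first by rewrite addn0 in kn; rewrite nth_default //; apply: (ideal0 II).
pose d := (size q).-1.
have ltd : (d < (k + d).+1)%N by rewrite ltnS leq_addl.
have := HqY (k + d)%N; rewrite coefM (bigD1 (Ordinal ltd)) //= addnK => Hs.
rewrite -[Y`_k]mul1r -uq -mulrA; apply: idealM => //.
set s := \sum_(i < _ | _) _ in Hs.
rewrite -[lead_coef q * _](addrK s); apply: idealB => //.
rewrite /s; apply: (big_ind I) => [|x y|i ni]; first exact: ideal0.
  exact: idealD.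
have [lti|gei] := ltnP i d.
  by apply: idealM => //; apply: IH; lia.
rewrite nth_default ?mul0r; first exact: ideal0.
have ltdi : (d < i)%N by rewrite ltn_neqAle eq_sym gei andbT.
exact: (leq_trans (leqSpred _) ltdi).
Qed.

Section ClusterCohenMacaulay.
Variables (K : fieldType) (V C : finType) (c : V -> C) (e : rel V).
Hypothesis eE : forall x y, e x y = (x != y) && (c x == c y).
Local Notation A := (edge_ring K e).
Local Notation x_ := (xv K e).

Let restriction_mono (W : {set V}) (tau : {rmorphism A -> A}) (m : V -> nat) :
  is_restriction W tau ->
  tau (\prod_v x_ v ^+ m v) =
    if [forall v, (m v == 0%N) || (v \in W)] then \prod_v x_ v ^+ m v else 0.
Proof.
move=> [_ tx]; rewrite rmorph_prod; case: ifP => [/forallP H|/forallPn[w]].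
  apply: eq_bigr => v _; rewrite rmorphXn tx.
  by have /orP[/eqP->|->] := H v; rewrite ?expr0.
rewrite negb_or => /andP[mw wW]; rewrite (bigD1 w) //= rmorphXn tx (negbTE wW).
by rewrite expr0n (negbTE mw) mul0r.
Qed.

(* A monomial divisible by two variables of the clique [i] vanishes, and the
   other ones are told apart by the restrictions. *)
Let restriction_clique (i : C) (tau0 : {rmorphism A -> A}) (tau : V -> {rmorphism A -> A}) :
  is_restriction [set w | c w != i] tau0 ->
  (forall v, is_restriction [set w | (c w != i) || (w == v)] (tau v)) ->
  forall y, y = tau0 y + \sum_(v | c v == i) (tau v y - tau0 y).
Proof.
move=> H0 Hv; apply: edge_mono_ind => [m|k a IH|a b IHa IHb]; last 2 first.
- rewrite {1}IH rmorphM H0.1 mulrDr mulr_sumr; congr (_ + _).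
  by apply: eq_bigr => v _; rewrite rmorphM (Hv v).1 mulrBr.
- rewrite {1}IHa {1}IHb rmorphD addrACA -big_split; congr (_ + _).
  by apply: eq_bigr => v _; rewrite rmorphD opprD addrACA.
set a := \prod_v _.
have tE v := restriction_mono m (Hv v).
have [/existsP[u /andP[/eqP cu mu]]|/existsPn nou] := boolP [exists u, (c u == i) && (m u != 0%N)].
  have -> : tau0 a = 0.
    rewrite (restriction_mono m H0) ifF //; apply/forallP=> /(_ u).
    by rewrite inE cu eqxx (negbTE mu).
  rewrite add0r (bigD1 u) ?cu //= subr0 big1 ?addr0 => [|v /andP[_ vu]]; last first.
    rewrite tE ifF ?subr0 //; apply/forallP=> /(_ u).
    by rewrite inE cu eqxx (negbTE mu) eq_sym (negbTE vu).
  rewrite tE; case: ifP => // /forallPn[w]; rewrite inE !negb_or negbK.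
  move=> /and3P[mw /eqP cw wu].
  rewrite /a (bigD1 u) //= (bigD1 w) //= mulrA.
  have -> : x_ u ^+ m u * x_ w ^+ m w = 0; last by rewrite mul0r.
  rewrite -(prednK (n := m u)) ?lt0n // -(prednK (n := m w)) ?lt0n //.
  by rewrite !exprS mulrACA xv_edge ?mul0r // eE eq_sym wu cu cw eqxx.
have H v : (m v == 0%N) || (c v != i).
  by have := nou v; rewrite negb_and negbK orbC.
have -> : tau0 a = a.
  by rewrite (restriction_mono m H0) ifT //; apply/forallP=> v; rewrite inE.
rewrite big1 ?addr0 // => v _; rewrite tE ifT ?subrr //; apply/forallP=> w.
by rewrite inE orbA H.
Qed.

Let t i : A := \sum_(v | c v == i) x_ v.

Definition clique_subst (B : comNzRingType) v (z : B) (y : V -> B) w : B :=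
  if c w == c v then if w == v then z else 0 else y w.

Let clique_subst_edge (B : comNzRingType) v (z : B) y u w :
  e u w -> y u * y w = 0 -> clique_subst v z y u * clique_subst v z y w = 0.
Proof.
rewrite eE /clique_subst => /andP[uw /eqP cuw] yy; rewrite cuw.
case: ifP => // _; have [uv|uv] := eqVneq u v; last by rewrite mul0r.
by rewrite -uv eq_sym (negbTE uw) mulr0.
Qed.

Variable p : C -> {poly K}.
Hypothesis p0 : forall i, p i != 0.
Let pt i : A := (map_poly (kc K e) (p i)).[t i].

Let theta_exists v : exists th : {rmorphism A -> {poly A}},
  [/\ forall k, th (kc K e k) = (kc K e k)%:P,
      forall w, c w != c v -> th (x_ w) = (x_ w)%:P, th (x_ v) = 'X &
      forall w, c w = c v -> w != v -> th (x_ w) = 0].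
Proof.
have [|th [thk thx]] := @edge_lift K V e {poly A} (polyC \o kc K e)
   (clique_subst v 'X (fun w => (x_ w)%:P)).
  move=> u w euw; apply: clique_subst_edge => //.
  by have := congr1 polyC (xv_edge K euw); rewrite polyCM polyC0.
exists th; split; [exact: thk|move=> w cw|move: (thx v)|move=> w cw wv].
- by move: (thx w); rewrite /clique_subst (negbTE cw).
- by rewrite /clique_subst !eqxx.
- by move: (thx w); rewrite /clique_subst cw eqxx (negbTE wv).
Qed.

Lemma pt_regular i l y : i \in codom c -> i \notin l ->
  lspan (map pt l) (pt i * y) -> lspan (map pt l) y.
Proof.
move=> /codomP[v0 ->] {i} il; set i := c v0 in il *.
have [th thP] := choice theta_exists.
have LI := lspan_is_ideal (map pt l).
have th_kc v j : map_poly (th v) (map_poly (kc K e) (p j)) = map_poly polyC (map_poly (kc K e) (p j)).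
  rewrite -!map_poly_comp; apply: eq_map_poly => k.
  by have [H _ _ _] := thP v; apply: H.
have th_t v j : j != c v -> th v (t j) = (t j)%:P.
  move=> jv; rewrite /t !rmorph_sum; apply: eq_bigr => w /eqP cw.
  by case: (thP v) => _ H _ _; rewrite H ?cw.
have th_tv v : th v (t (c v)) = 'X.
  case: (thP v) => _ _ Hv Hw; rewrite /t rmorph_sum (bigD1 v) //= Hv.
  by rewrite big1 ?addr0 // => w /andP[/eqP cw wv]; apply: Hw.
have th_pt v j : j != c v -> th v (pt j) = (pt j)%:P.
  by move=> jv; rewrite /pt -horner_map th_kc th_t // horner_map.
have th_ptv v : th v (pt (c v)) = map_poly (kc K e) (p (c v)).
  by rewrite /pt -horner_map th_kc th_tv -[LHS]/(_ \Po 'X) comp_polyXr.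
have th_span v a : c v = i -> lspan (map pt l) a -> forall k, lspan (map pt l) (th v a)`_k.
  move=> cv; elim: l il LI a => [|j l IH] il LI a /=; first by move=> -> k; rewrite rmorph0 coef0.
  move: il; rewrite inE negb_or => /andP[ij il].
  move=> [b [a' [la' ->]]] k.
  exists (th v b)`_k, (th v a')`_k; split; first by apply: IH => //; apply: lspan_is_ideal.
  by rewrite rmorphD rmorphM th_pt ?cv 1?eq_sym // coefD coefMC.
move=> ly; have th_y v : c v = i -> forall k, lspan (map pt l) (th v y)`_k.
  move=> cv; apply: (@ideal_coef_mul _ _ (map_poly (kc K e) (p i)) _
      (kc K e (lead_coef (p i))^-1)) => //.
    by rewrite lead_coef_map -rmorphM mulVf ?rmorph1 // lead_coef_eq0.
  move=> k; rewrite -cv -th_ptv -rmorphM cv; exact: th_span.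
have [tau0 tau0P] := restriction_exists K e [set w | c w != i].
have [tau tauP] := choice (fun v => restriction_exists K e [set w | (c w != i) || (w == v)]).
have tauE v : c v = i -> tau v y = (th v y).[x_ v].
  move=> cv; have [tk tx] := tauP v; have [thk thx thv thw] := thP v.
  apply: (@edge_morph_eq K V e A (tau v) (horner_eval (x_ v) \o th v)) => [k|w] /=.
    by rewrite tk thk /horner_eval hornerC.
  rewrite tx inE /horner_eval; have [cw|cw] /= := eqVneq (c w) i; last by rewrite thx ?hornerC ?cv.
  have [->|wv] := eqVneq w v; first by rewrite thv hornerX.
  by rewrite thw ?cw ?horner0.
have tau0E : tau0 y = (th v0 y).[0].
  have [tk tx] := tau0P; have [thk thx thv thw] := thP v0.
  apply: (@edge_morph_eq K V e A tau0 (horner_eval 0 \o th v0)) => [k|w] /=.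
    by rewrite tk thk /horner_eval hornerC.
  rewrite tx inE /horner_eval; have [cw|cw] /= := eqVneq (c w) i; last by rewrite thx ?hornerC.
  have [->|wv] := eqVneq w v0; first by rewrite thv hornerX.
  by rewrite thw ?horner0.
have horner_span (q : {poly A}) z : (forall k, lspan (map pt l) q`_k) -> lspan (map pt l) q.[z].
  move=> Hq; rewrite horner_coef; apply: (big_ind (lspan (map pt l))) => [|u v|k _].
  - exact: ideal0.
  - exact: idealD.
  - by rewrite mulrC; apply: idealM.
have l0 : lspan (map pt l) (tau0 y) by rewrite tau0E; apply/horner_span/th_y.
rewrite (restriction_clique tau0P tauP y); apply: idealD => //.
apply: (big_ind (lspan (map pt l))) => [|u v|v /eqP cv]; first exact: ideal0.
  exact: idealD.
by apply: idealB => //; rewrite tauE //; apply/horner_span/th_y.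
Qed.

Lemma pt_regular_sequence (P : {pred A}) : prime_ideal P -> (forall i, pt i \in P) ->
  regular_sequence (map pt (enum (codom c))).
Proof.
move=> PP ptP; split.
  move=> k; rewrite size_map => kS a /ideal_spanP.
  have [i0 _] : exists i0 : C, True.
    by case: (enum (codom c)) kS => // i l _; exists i.
  rewrite (nth_map i0) // -map_take => H; apply/ideal_spanP; apply: pt_regular H.
    by rewrite -mem_enum mem_nth.
  by rewrite in_take ?mem_nth // index_uniq ?enum_uniq // ltnn.
apply/negP=> /ideal_spanP sp1; have /negP := prime1 PP; apply.
by apply: (lspan_ideal (idealr_is_ideal PP.1)) sp1 => _ /mapP[i _ ->].
Qed.
End ClusterCohenMacaulay.

Lemma cluster_cohen_macaulay (K : fieldType) (V C : finType) (c : V -> C) (e : rel V) :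
  (forall x y, e x y = (x != y) && (c x == c y)) -> cohen_macaulay_graph K e.
Proof.
move=> eE; split; first exact/noeth_noetherian/edge_noeth.
move=> P MP; have PP := maximal_prime MP.
have bound := @edge_chain_bound K V e #|codom c| P _ _ (cluster_independent_card eE).
have ex i : exists p : {poly K}, p != 0 /\
    (map_poly (kc K e) p).[\sum_(v | c v == i) xv K e v] \in P.
  by have [p p0 pP] := maximal_algebraic (\sum_(v | c v == i) xv K e v) MP; exists p.
have [p pP] := choice ex.
set xs := [seq (map_poly (kc K e) (p i)).[\sum_(v | c v == i) xv K e v] | i <- enum (codom c)].
have reg : regular_sequence xs.
  by apply: (pt_regular_sequence eE (fun i => (pP i).1) PP) => i; case: (pP i).
have xsP : {subset xs <= P} by move=> _ /mapP[i _ ->]; case: (pP i).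
have sxs : size xs = #|codom c| by rewrite size_map -cardE.
exists #|codom c|; split; split.
- by rewrite -sxs; apply: regular_prime_chain => //; apply: edge_noeth.
- by move=> n Q; apply: bound.
- by exists xs.
- move=> ys regy ysP; have [Q chain] := regular_prime_chain (@edge_noeth K V e) regy PP ysP.
  exact: bound chain.
Qed.

(** * Connectedness in codimension one *)

Lemma mpolyX_eq0 (K : fieldType) n (m : 'X_{1..n}) : ('X_[m] == 0 :> {mpoly K[n]}) = false.
Proof.
by apply/eqP=> /(congr1 (mcoeff m)); rewrite mcoeffX eqxx mcoeff0 => /eqP; rewrite oner_eq0.
Qed.

Section CohenMacaulayPrivate.
Variables (K : fieldType) (V : finType) (e : rel V).
Hypotheses (e_sym : ssrbool.symmetric e) (e_irr : irreflexive e).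
Local Notation S := {mpoly K[#|V|]}.
Local Notation A := (edge_ring K e).
Local Notation x_ := (xv K e).

Let ev0_exists : exists ev0 : {rmorphism A -> K},
  (forall k, ev0 (kc K e k) = k) /\ (forall v, ev0 (x_ v) = 0).
Proof. by apply: (@edge_lift K V e K idfun (fun=> 0)) => u v _; rewrite mulr0. Qed.

Lemma kernel_prime (B : comNzRingType) (D : idomainType) (f : {rmorphism B -> D})
  (P : {pred B}) : (forall a, (a \in P) = (f a == 0)) -> prime_ideal P.
Proof.
move=> PE; split=> [|u v]; last by rewrite !PE rmorphM mulf_eq0.
split=> [||a u v]; rewrite !PE ?rmorph0 ?rmorph1 ?oner_eq0 //.
by move=> /eqP fu /eqP fv; rewrite rmorphD rmorphM fu fv mulr0 addr0.
Qed.

Variable F : {set V}.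
Hypothesis MF : maxset (independent e) F.

Let in_PF (a : A) := lspan [seq x_ v | v in ~: F] a.
Let in_IB (b : A) := forall v, v \notin F -> b * x_ v = 0.

Let PF_ideal : is_ideal in_PF. Proof. exact: lspan_is_ideal. Qed.

Let PF_IB a b : in_PF a -> in_IB b -> a * b = 0.
Proof.
move=> aP bI; apply: (@lspan_ideal _ (fun z => z * b = 0)) aP.
  by split=> [|k u v ub vb]; rewrite ?mul0r // mulrDl -mulrA ub vb mulr0 addr0.
by move=> _ /mapP[v + ->]; rewrite mem_enum inE => /bI; rewrite mulrC.
Qed.

Let face_ker_gen (G : {set V}) (rho : {rmorphism A -> S}) : is_face_eval G rho ->
  forall a, lspan [seq x_ v | v in ~: G] a -> rho a = 0.
Proof.
move=> [rk rx] a; apply: (@lspan_ideal _ (fun z => rho z = 0)).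
  by split=> [|k u v ub vb]; rewrite ?rmorph0 // rmorphD rmorphM ub vb mulr0 addr0.
by move=> _ /mapP[v + ->]; rewrite mem_enum inE rx => /negbTE->.
Qed.

Section NoPrivate.
Hypothesis nopriv : ~ has_private_nbr e F.
Let nbr b := [set a in F | e b a].

Let nbr_gt1 b : b \notin F -> (1 < #|nbr b|)%N.
Proof.
move=> bF; have [a aF eba] := maxindep_nbr e_sym e_irr MF bF.
rewrite ltnNge; apply/negP => le1; apply: nopriv; exists a, b; split=> // a' a'F eba'.
have /card_le1_eqP H := le1.
by apply: H; rewrite inE ?aF ?eba ?a'F ?eba'.
Qed.

Let IF : independent e F. Proof. by case/maxsetP: MF. Qed.

Let decomposed b (g : A) := exists pi nu, [/\ g = pi + nu, in_PF pi & nu * x_ b = 0].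

Let dependent_nbr b (zs : seq A) : b \notin F -> (#|F|.-1 <= size zs)%N ->
  exists2 h, lexnz zs h & decomposed b h.
Proof.
move=> bF szs; pose G := F :\: nbr b.
have IG : independent e G by apply: independentS IF; apply: subsetDl.
have ltG : (#|G| < size zs)%N.
  apply: leq_trans szs; have := nbr_gt1 bF.
  have sub : nbr b \subset F by apply/subsetP=> a; rewrite inE => /andP[].
  have := cardsID (nbr b) F; rewrite (setIidPr sub) -/G.
  by move: #|nbr b| #|G| #|F| => i j k; lia.
have [rho rhoP] := face_eval_exists K IG.
have [h hz /(face_eval_ker rhoP) hs] := face_eval_dependent rhoP ltG.
exists h => //; apply: (@lspan_ideal _ (decomposed b)) hs.
  split; first by exists 0, 0; split; rewrite ?addr0 ?mul0r //; apply: ideal0.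
  move=> k _ _ [p [n [-> pP nb]]] [p' [n' [-> pP' nb']]].
  exists (k * p + p'), (k * n + n'); split; [ring|exact: PF_ideal.2|].
  by rewrite mulrDl -mulrA nb nb' mulr0 addr0.
move=> _ /mapP[v + ->]; rewrite mem_enum !inE negb_and negbK.
have [vF|vF] := boolP (v \in F); rewrite ?orbF /= => vb.
  exists 0, (x_ v); split; rewrite ?add0r //; first exact: ideal0.
  by rewrite xv_edge // e_sym.
exists (x_ v), 0; split; rewrite ?addr0 ?mul0r //.
by apply: mem_lspan; apply: map_f; rewrite mem_enum inE.
Qed.

Let dependent_all (zs : seq A) : (#|F|.-1 <= size zs)%N ->
  exists g al be, [/\ lexnz zs g, g = al + be, in_PF al & in_IB be].
Proof.
move=> szs.
suff H (bs : seq V) : (forall b, b \in bs -> b \notin F) ->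
    exists g al be, [/\ lexnz zs g, g = al + be, in_PF al &
      forall b, b \in bs -> be * x_ b = 0].
  have [|g [al [be [gz gE alP beP]]]] := H (enum (~: F)).
    by move=> b; rewrite mem_enum inE.
  exists g, al, be; split=> // v vF; apply: beP.
  by rewrite mem_enum inE.
elim: bs => [|b bs IH] bsF.
  exists 1, 0, 1; split=> //; [exact: lexnz1|by rewrite add0r|exact: ideal0].
have [|g [al [be [gz gE alP beP]]]] := IH.
  by move=> b' b'bs; apply: bsF; rewrite inE b'bs orbT.
have [h hz [p [n [hE pP nb]]]] := dependent_nbr (bsF b (mem_head _ _)) szs.
exists (g * h), (h * al + be * p), (be * n); split.
- exact: lexnzM.
- by rewrite {1}gE mulrDl {2}hE; ring.
- by apply: idealD => //; apply: idealM.
- move=> b'; rewrite inE => /orP[/eqP->|/beP b'P]; first by rewrite -mulrA nb mulr0.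
  by rewrite mulrAC b'P mul0r.
Qed.

Variable ev0 : {rmorphism A -> K}.
Hypothesis ev0P : (forall k, ev0 (kc K e k) = k) /\ (forall v, ev0 (x_ v) = 0).
Let m : {pred A} := fun a => ev0 a == 0.

Let m_prime : prime_ideal m. Proof. exact: (@kernel_prime A K ev0). Qed.

Let face_eval_local (G : {set V}) (rho : {rmorphism A -> S}) : is_face_eval G rho ->
  forall a, a \notin m -> rho a != 0.
Proof.
move=> rhoP a; apply: contraNneq => /(face_eval_ker rhoP).
apply: (lspan_ideal (idealr_is_ideal m_prime.1)) => _ /mapP[v _ ->].
by apply/eqP; case: ev0P.
Qed.

Let no_regular_sequence ys b0 : b0 \notin F -> ys != [::] -> (#|F| <= size ys)%N ->
  ~ regular_mod m (fun a => a = 0) ys.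
Proof.
move=> b0F ys0 sys reg.
pose I0 (a : A) := a = 0.
have II : is_ideal I0 by split=> // a u v -> ->; rewrite mulr0 addr0.
have NA := @edge_noeth K V e.
have den i : (i < size ys)%N -> exists g al be,
    [/\ lexnz (take i ys ++ drop i.+1 ys) g, g = al + be, in_PF al & in_IB be].
  move=> iS; apply: dependent_all.
  rewrite size_cat (size_takel (ltnW iS)) size_drop.
  by move: sys iS; move: #|F| (size ys) => q r; lia.
have sys0 : (0 < size ys)%N by rewrite lt0n size_eq0.
have [g [al [be [gz gE alP beI]]]] := den 0%N sys0.
have gys : lexnz ys g.
  by case: (ys) gz ys0 => // y ys'; rewrite take0 /= drop0 => H _; apply: lexnz_cons.
have greg z : sat m I0 (g * z) -> sat m I0 z by apply: (regular_lexnz NA m_prime II reg gys).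
have [|s sm [c sc _]] := regular_fraction NA m_prime (a := al) II reg ys0 greg.
  move=> i /den[h [al' [be' [hz hE alP' beI']]]]; exists h => //.
  apply: (sat_in m_prime); exists al' => //.
  have -> : h * al - g * al' = al * be' - al' * be by rewrite hE gE; ring.
  by rewrite /I0 (PF_IB alP beI') (PF_IB alP' beI) subrr.
have {}sc : (s - c) * al = c * be.
  by apply/eqP; rewrite -subr_eq0; apply/eqP; rewrite -[RHS]sc gE; ring.
have [cm|cm] := boolP (c \in m).
  have scm : s - c \notin m.
    by rewrite (primeDr m_prime) // -mulN1r (primeM m_prime) cm orbT.
  have [t tm It] : sat m I0 ((s - c) * x_ b0).
    apply: greg; apply: (sat_in m_prime); rewrite /I0 gE.
    have -> : (al + be) * ((s - c) * x_ b0) = (s - c) * al * x_ b0 + (s - c) * (be * x_ b0) by ring.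
    by rewrite sc -mulrA beI // !mulr0 addr0.
  have [rho rhoP] := face_eval_exists K (independent1 e_irr b0).
  have := congr1 rho It; rewrite rmorph0 !rmorphM rhoP.2 set11 => /eqP.
  have tn0 := face_eval_local rhoP tm; have sn0 := face_eval_local rhoP scm.
  by rewrite !mulf_eq0 (negbTE tn0) (negbTE sn0) mpolyX_eq0.
have [rho rhoP] := face_eval_exists K IF.
have cn0 := face_eval_local rhoP cm.
have rbe : rho be = 0.
  have : rho (c * be) = 0.
    by rewrite -sc; apply: (face_ker_gen rhoP); apply: idealM.
  by rewrite rmorphM => /eqP; rewrite mulf_eq0 (negbTE cn0) => /eqP.
have gP : in_PF g.
  apply: (face_eval_ker rhoP); rewrite gE rmorphD rbe addr0.
  exact: (face_ker_gen rhoP).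
have [t tm It] : sat m I0 (\prod_(v in F) x_ v).
  apply: greg; apply: (sat_in m_prime); apply: PF_IB => // v vF.
  have [a aF eva] := maxindep_nbr e_sym e_irr MF vF.
  by rewrite (bigD1 a) //= mulrC mulrA xv_edge ?mul0r.
have := congr1 rho It; rewrite rmorph0 !rmorphM rmorph_prod => /eqP.
have tn0 := face_eval_local rhoP tm.
rewrite mulf_eq0 (negbTE tn0) /=; apply/negP/prodf_neq0 => v vF.
by rewrite rhoP.2 vF mpolyX_eq0.
Qed.

Let m_maximal : maximal_ideal m.
Proof.
split; first by case: m_prime.
move=> J JI mJ a aJ; apply: contraT => am.
have II := idealr_is_ideal JI; have [_ J1 _] := JI; case/negP: J1.
have ka : kc K e (ev0 a) \in J.
  rewrite -[kc _ _ _](subKr a); apply: (idealB II) => //; apply: mJ.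
  by rewrite unfold_in /m rmorphB ev0P.1 subrr.
have -> : 1 = kc K e (ev0 a)^-1 * kc K e (ev0 a) by rewrite -rmorphM mulVf ?rmorph1.
exact: (idealM II).
Qed.

Let face_chain : exists Q, prime_chain_to m #|F| Q.
Proof.
pose Fi i := [set v in drop i (enum F)].
have FiF i : Fi i \subset F.
  by apply/subsetP=> v; rewrite inE => /mem_drop; rewrite mem_enum.
have ex i := face_eval_exists K (independentS (FiF i) IF).
have [rho rhoP] := choice ex.
exists (fun i a => rho i a == 0); split.
- by move=> i _; apply: (@kernel_prime A S (rho i)).
- move=> i iF; split=> [a /eqP/(face_eval_ker (rhoP i)) aE|].
    apply/eqP; apply: (face_ker_gen (rhoP i.+1)); apply: lspan_sub aE.
    move=> _ /mapP[v + ->]; rewrite mem_enum !inE => vi; apply: map_f.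
    rewrite mem_enum !inE; apply: contra vi.
    by rewrite -addn1 addnC -drop_drop => /mem_drop.
  have [v0 _] : exists v0 : V, True.
    by case/card_gt0P: (leq_ltn_trans (leq0n _) iF) => v _; exists v.
  have iS : (i < size (enum F))%N by rewrite -cardE.
  pose v := nth v0 (enum F) i.
  move=> /(_ (x_ v)); rewrite !unfold_in (rhoP i).2 (rhoP i.+1).2 !inE.
  have -> : v \in drop i (enum F) by rewrite (drop_nth v0 iS) mem_head.
  have -> : (v \in drop i.+1 (enum F)) = false.
    have := drop_uniq i (enum_uniq F); rewrite (drop_nth v0 iS) cons_uniq => /andP[H _].
    exact: negbTE.
  by rewrite eqxx mpolyX_eq0 => /(_ isT).
- move=> a; rewrite !unfold_in /=.
  have -> : rho #|F| a = (ev0 a)%:MP.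
    apply: (@edge_morph_eq K V e S (rho #|F|) (@mpolyC #|V| K \o ev0)) => [k|v] /=.
      by rewrite (rhoP _).1 ev0P.1.
    rewrite (rhoP _).2 ev0P.2 mpolyC0 inE drop_oversize //.
    by rewrite -cardE.
  by rewrite mpolyC_eq0.
Qed.

Lemma no_private_nbr_not_cohen_macaulay : F != setT -> ~ cohen_macaulay_graph K e.
Proof.
move=> FT [_ CM].
have [b0 b0F] : exists b0, b0 \notin F.
  apply: contrapT => nob; case/eqP: FT; apply/setP=> v; rewrite inE.
  by apply: contraT => vF; exfalso; apply: nob; exists v.
have [d [[_ le_d] [[xs [reg xsm sxs]] _]]] := CM m m_maximal.
have [Q chain] := face_chain; have Fd := le_d _ _ chain.
have F0 : (0 < #|F|)%N.
  have [a aF _] := maxindep_nbr e_sym e_irr MF b0F.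
  by apply/card_gt0P; exists a.
apply: (@no_regular_sequence xs b0 b0F); rewrite ?sxs //.
  by rewrite -size_eq0 sxs -lt0n (leq_trans F0).
exact: regular_sequence_mod.
Qed.
End NoPrivate.

Lemma cohen_macaulay_private : F != setT -> cohen_macaulay_graph K e ->
  has_private_nbr e F.
Proof.
move=> FT CM; apply: contrapT => nopriv; have [ev0 ev0P] := ev0_exists.
exact: (no_private_nbr_not_cohen_macaulay nopriv ev0P).
Qed.
End CohenMacaulayPrivate.

Section UnitaryCayley.
Variable R : finUnitRingType.
Local Notation G := (@unitary_cayley R).

Lemma unitary_cayley01 : unitary_cayley (0 : R) 1.
Proof. by rewrite /unitary_cayley /= eq_sym oner_eq0 sub0r unitrN unitr1. Qed.

Lemma unitary_cayley_private :
  (forall F, maxset (independent G) F -> has_private_nbr G F) ->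
  is_field R \/ exists k : nat, (0 < k)%N /\ is_Z2_power R k.
Proof.
by move=> /field_or_boolean_cayley[|/boolean_Z2_power]; [left|right].
Qed.

Lemma unitary_cayley_maxindep F : maxset (independent G) F -> F != setT.
Proof.
move=> /maxsetP[/forall_inP IF _]; apply/eqP=> FT.
have /forall_inP/(_ 1) : [forall y in F, ~~ unitary_cayley 0 y] by apply: IF; rewrite FT inE.
by rewrite FT inE unitary_cayley01 => /(_ isT).
Qed.
End UnitaryCayley.

Theorem theorem3p9 (R : finUnitRingType) (K : fieldType) :
  (cohen_macaulay_graph K (@unitary_cayley R) <->
   well_covered (@unitary_cayley R) /\ shellable (@unitary_cayley R)) /\
  (well_covered (@unitary_cayley R) /\ shellable (@unitary_cayley R) <->
   is_field R \/ exists k : nat, (0 < k)%N /\ is_Z2_power R k).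
Proof.
have sym := @unitary_cayley_sym R; have irr := @unitary_cayley_irr R.
have of_cm : cohen_macaulay_graph K (@unitary_cayley R) ->
    is_field R \/ exists k : nat, (0 < k)%N /\ is_Z2_power R k.
  move=> CM; apply: unitary_cayley_private => F MF.
  exact (cohen_macaulay_private sym irr MF (unitary_cayley_maxindep MF) CM).
have of_shell : well_covered (@unitary_cayley R) /\ shellable (@unitary_cayley R) ->
    is_field R \/ exists k : nat, (0 < k)%N /\ is_Z2_power R k.
  move=> [wc sh]; apply: unitary_cayley_private.
  by apply: shellable_private => //; exists 0, 1; apply: unitary_cayley01.
have to_cm : (is_field R \/ exists k : nat, (0 < k)%N /\ is_Z2_power R k) ->
    cohen_macaulay_graph K (@unitary_cayley R).
  case=> [/field_cluster|[k [_ /Z2_power_cluster]]]; exact: cluster_cohen_macaulay.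
have to_shell : (is_field R \/ exists k : nat, (0 < k)%N /\ is_Z2_power R k) ->
    well_covered (@unitary_cayley R) /\ shellable (@unitary_cayley R).
  case=> [/field_cluster|[k [_ /Z2_power_cluster]]] eE;
    split; by [apply: cluster_well_covered eE | apply: cluster_shellable eE].
split; split.
- by move=> /of_cm/to_shell.
- by move=> /of_shell/to_cm.
- exact: of_shell.
- exact: to_shell.
Qed.
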